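(* For each $0<\alpha<1$ and any cube $\mathfrak{Q}\subseteq\mathsf{T}_d$ we have: (i) for $d=2$, $$\dim\mathcal{D}_{\alpha,2}(\mathfrak{Q})\ge\min\{3/2,\ 3(1-\alpha)\};$$ (ii) for every integer $d\ge3$, $$\dim\mathcal{D}_{\alpha,d}(\mathfrak{Q})\ge\min\{\kappa_d,\ 2\kappa_d(1-\alpha)\}.$$
   Context: $\mathsf{T}_d=(\mathbb{R}/\mathbb{Z})^d$ is identified with $[0,1)^d$; cubes are axis-parallel with positive side length. For a sequence $(x_n)_{n\in\mathbb{N}}$ in $[0,1)$ its (unnormalized) discrepancy at length $N$ is $$D_N=\sup_{0\le a<b\le1}\bigl|\#\{1\le n\le N:\ x_n\in(a,b)\}-(b-a)N\bigr|.$$ For $\mathbf{x}=(x_1,\dots,x_d)\in\mathsf{T}_d$, $D_d(\mathbf{x};N)$ denotes the discrepancy at length $N$ of the sequence of fractional parts of $x_1n+\dots+x_dn^d$, $n\in\mathbb{N}$. Define $$\mathcal{D}_{\alpha,d}=\{\mathbf{x}\in\mathsf{T}_d:\ D_d(\mathbf{x};N)\ge N^{\alpha}\text{ for infinitely many }N\in\mathbb{N}\},\qquad\mathcal{D}_{\alpha,d}(\mathfrak{Q})=\mathcal{D}_{\alpha,d}\cap\mathfrak{Q}.$$ $\dim$ denotes the Hausdorff dimension, and $$\kappa_d=\max_{\nu=1,\dots,d}\ \min\left\{\frac{1}{2\nu},\ \frac{1}{2d-\nu}\right\}.$$ *)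

(* Defs.v *)
From mathcomp Require Import all_boot all_order all_algebra.
From mathcomp Require Import all_classical all_reals all_analysis.
Set Implicit Arguments.
Unset Strict Implicit.
Unset Printing Implicit Defensive.
Import Order.TTheory GRing.Theory Num.Theory.
Local Open Scope classical_set_scope.
Local Open Scope ring_scope.

Section hausdorff_dimension.
Context {R : realType} {d : nat}.
Implicit Types (A U : set 'rV[R]_d) (s delta : R).

(* The library norm on row vectors is the sup norm, hence this definition. *)
Definition eucl_dist (x y : 'rV[R]_d) : R :=
  Num.sqrt (\sum_(i < d) (x 0 i - y 0 i) ^+ 2).

(* The maximum with 0 only matters for the empty set: ereal_sup set0 = -oo. *)
Definition diam U : \bar R :=
  maxe 0%E (ereal_sup [set (eucl_dist p.1 p.2)%:E | p in U `*` U]).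

(* Finite covers are included, since sets of the cover may be empty. *)
Definition delta_cover delta A (U : nat -> set 'rV[R]_d) : Prop :=
  A `<=` \bigcup_k U k /\ forall k, (diam (U k) <= delta%:E)%E.

Definition hausdorff_premeasure s delta A : \bar R :=
  ereal_inf [set (\sum_(0 <= k <oo) ((fine (diam (U k))) `^ s)%:E)%E
            | U in delta_cover delta A].

(* The premeasure is nonincreasing in delta, so that the limit at 0+ is
   the supremum. *)
Definition hausdorff_measure s A : \bar R :=
  ereal_sup [set hausdorff_premeasure s delta A | delta in [set e : R | 0 < e]].

(* Taking s > 0 makes the value of 0 `^ 0 irrelevant. *)
Definition hausdorff_dim A : \bar R :=
  ereal_inf [set s%:E | s in [set s : R | 0 < s /\ hausdorff_measure s A = 0%E]].

End hausdorff_dimension.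

Section discrepancy.
Context {R : realType}.

(* The supremum is over a nonempty set of reals bounded by N. *)
Definition discrepancy (x : nat -> R) (N : nat) : R :=
  sup [set r | exists a b : R, [/\ 0 <= a, a < b, b <= 1 &
    r = `|(\sum_(1 <= n < N.+1 | (a < x n < b)%R) 1)%N%:R - (b - a) * N%:R|]].

Definition frac_part (y : R) : R := y - (Num.floor y)%:~R.

(* Coordinates are numbered from 0: the i-th one is the coefficient of
   n ^ (i + 1). *)
Definition weyl_seq (d : nat) (x : 'rV[R]_d) (n : nat) : R :=
  frac_part (\sum_(i < d) x 0 i * n%:R ^+ i.+1).

Definition torus (d : nat) : set 'rV[R]_d :=
  [set x | forall i, 0 <= x 0 i < 1].

(* Each face may or may not belong to the cube. *)
Definition is_cube (d : nat) (Q : set 'rV[R]_d) : Prop :=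
  exists (c : 'rV[R]_d) (l : R) (bl br : 'I_d -> bool), 0 < l /\
    Q = [set x | forall i, x 0 i \in
          Interval (BSide (bl i) (c 0 i)) (BSide (br i) (c 0 i + l))].

Definition large_discrepancy (alpha : R) (d : nat) : set 'rV[R]_d :=
  [set x | torus x /\
    infinite_set [set N : nat | N%:R `^ alpha <= discrepancy (weyl_seq x) N]].

(* All the terms are positive, so the initial value 0 plays no role when
   0 < d. *)
Definition kappa (d : nat) : R :=
  \big[Num.max/0]_(1 <= nu < d.+1)
    Num.min (1 / (2 * nu%:R)) (1 / (2 * d%:R - nu%:R)).

End discrepancy.
Arguments torus : clear implicits.
Arguments is_cube {R} d Q.
Arguments large_discrepancy {R} alpha d.
Arguments kappa R d : clear implicits.

(* Main.v *)
Require Import Defs.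
From mathcomp Require Import all_boot all_order all_algebra.
From mathcomp Require Import all_classical all_reals all_analysis.
From mathcomp Require Import ring lra zify.
Set Implicit Arguments.
Unset Strict Implicit.
Unset Printing Implicit Defensive.
Import Order.TTheory GRing.Theory Num.Theory numFieldNormedType.Exports.
Local Open Scope classical_set_scope.
Local Open Scope ring_scope.

(** The sequence [x_1 n + x_2 n ^ 2 + ...] has a large discrepancy when [x_1] and
    [x_2] are close to fractions with the same square denominator [q = p ^ 2].
    Suppose that [x_1 = b / q + d1] and [x_2 = a / q + d2], with [2 * a] prime to
    [p], and that the other coordinates are fractions with a fixed denominator
    dividing [p]. For [d1 = d2 = 0] the Weyl sum of length [N], a multiple of
    [q], is a Gauss sum: splitting [n] into its residue modulo [p] and its
    quotient, all the residues but one contribute 0, and the absolute value is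
    exactly [N / p]. If [d1 <= 1 / N] and [d2 <= 1 / N ^ 2], the perturbation has
    bounded variation up to [N]; so summation by parts bounds the rational sum by
    the largest perturbed sum of length at most [N], and Koksma's inequality
    bounds the latter by the discrepancies at lengths at most [N]. Hence one of
    these discrepancies is at least of order [N / sqrt q]
    ([quadratic_discrepancy]). This exceeds [N ^ alpha] when [N] is about
    [q ^ tau] with [tau > 1 / (2 * (1 - alpha))].

    The set of points with such approximations for infinitely many [q] contains
    a product of two Cantor sets given by base-3 digits: with [q = 3 ^ Q] and
    [N = 3 ^ M], the digits are 0 from position [Q] to [M] in the first coordinate
    and from [Q] to [2 * M] in the second one, the digit before the zeros is 1 in
    the second coordinate, and all the other digits are free. The positions [Q]
    grow geometrically with a large ratio, so that up to position [Q] nearly all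
    digits are free. Counting the free digits up to [j], the two worst positions
    are [j = M] and [j = 2 * M], where at least about [2 * Q] and
    [2 * Q + M] of the [2 * j] digits are free. The dimension is therefore at
    least [min (2 / tau) (1 / tau + 1 / 2)], up to a small error, and both terms
    are at least [3 / (2 * tau)] when [tau >= 1] ([digits_growth]). Letting [tau]
    tend to the larger of [1] and [1 / (2 * (1 - alpha))] gives the bound
    [min (3 / 2) (3 * (1 - alpha))] in every dimension [d >= 2]
    ([large_discrepancy_dim]). For [d >= 3] it is more than what is asked,
    because [kappa_d <= 1 / 2].

    The lower bound on the Hausdorff dimension comes from a mass distribution
    principle with counting measures on finite sets in place of a measure on the
    Cantor set ([mass_distribution], [cantor_dust_measure]). *)

(** * Koksma's inequality *)

Section trigonometric_sums.
Context {R : realType}.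
Implicit Types (t x y : R).

(* The cosine with angles measured in turns, so that it has period 1. *)
Local Notation tcos t := (cos (2 * pi * t)).

Lemma tcosDn t (n : nat) : tcos (t + n%:R) = tcos t.
Proof.
rewrite mulrDr.
have -> : 2 * pi * n%:R = (pi *+ 2) *+ n :> R.
  by rewrite -[RHS]mulr_natr -[pi *+ 2]mulr_natl.
by rewrite periodicn//; exact: cosD2pi.
Qed.

Lemma tcosDz t (z : int) : tcos (t + z%:~R) = tcos t.
Proof.
case: z => n; first by rewrite tcosDn.
by rewrite -[LHS](tcosDn _ n.+1) NegzE mulrNz addrNK.
Qed.

Lemma cos_lipschitz x y : `|cos x - cos y| <= `|x - y|.
Proof.
wlog xy : x y / x <= y.
  move=> h; case: (leP x y) => [/h//|/ltW/h].
  by rewrite distrC (distrC y).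
have [c _ cE] : exists2 c, c \in `[x, y]%R & cos y - cos x = - sin c * (y - x).
  apply: (@MVT_segment _ cos (fun c => - sin c)) => //.
  exact/continuous_subspaceT/continuous_cos.
by rewrite distrC cE (distrC x) normrM normrN ler_piMl// sin_max.
Qed.

Lemma tcos_lipschitz x y : `|tcos x - tcos y| <= 2 * pi * `|x - y|.
Proof.
apply: le_trans (cos_lipschitz _ _) _.
by rewrite -mulrBr normrM ger0_norm// mulr_ge0// pi_ge0.
Qed.

(** Multiplied by [2 * sin (pi * r / p)], where [r] is the residue of [j]
    modulo [p], the sum telescopes; this factor is positive since
    [0 < r < p]. *)
Lemma tcos_sum_eq0 t (j p V : nat) : (0 < p)%N -> (p %| V)%N -> ~~ (p %| j)%N ->
  \sum_(0 <= v < V) tcos (t + j%:R * v%:R / p%:R) = 0.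
Proof.
move=> p0 pV pj.
have p0' : (p%:R : R) != 0 by rewrite pnatr_eq0 -lt0n.
pose r := (j %% p)%N.
have r0 : (0 < r)%N by rewrite lt0n.
have rp : (r < p)%N by rewrite ltn_mod.
have s0 : 0 < sin (pi * r%:R / p%:R) :> R.
  apply: sin_gt0_pi; rewrite divr_gt0 ?mulr_gt0 ?pi_gt0 ?ltr0n//=.
  by rewrite ltr_pdivrMr ?ltr0n// ltr_pM2l ?pi_gt0// ltr_nat.
pose g (v : nat) := sin (2 * pi * (t + r%:R * (v%:R - 2^-1) / p%:R)) : R.
have step v : 2 * sin (pi * r%:R / p%:R) * tcos (t + j%:R * v%:R / p%:R)
    = g v.+1 - g v.
  have -> : t + j%:R * v%:R / p%:R
      = t + r%:R * v%:R / p%:R + ((j %/ p) * v)%:R.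
    rewrite {1}(divn_eq j p) natrD !natrM -/r; field.
    exact: p0'.
  rewrite tcosDn /g.
  set A := 2 * pi * (t + _ * v%:R / _); set B := pi * _ / _.
  have -> : 2 * pi * (t + r%:R * (v.+1%:R - 2^-1) / p%:R) = A + B.
    by rewrite /A /B -natr1; field.
  have -> : 2 * pi * (t + r%:R * (v%:R - 2^-1) / p%:R) = A - B.
    by rewrite /A /B; field.
  by rewrite sinD sinB; ring.
have s0' : 2 * sin (pi * r%:R / p%:R) != 0 :> R by rewrite mulf_neq0// gt_eqF.
apply: (mulfI s0'); rewrite mulr0 mulr_sumr (eq_bigr _ (fun i _ => step i)).
rewrite telescope_sumr// /g.
move: pV => /dvdnP[w ->].
have -> : 2 * pi * (t + r%:R * ((w * p)%:R - 2^-1) / p%:R)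
   = 2 * pi * (t + r%:R * (0%:R - 2^-1) / p%:R) + (pi *+ 2) *+ (r * w) :> R.
  rewrite -[_ *+ (r * w)]mulr_natr -[pi *+ 2]mulr_natl !natrM; field.
  exact: p0'.
by rewrite periodicn ?subrr//; exact: sinD2pi.
Qed.

Lemma frac_part_itv x : 0 <= frac_part x < 1.
Proof.
rewrite /frac_part subr_ge0 ltrBlDl; have := floor_itv x.
by rewrite intrD addrC.
Qed.
Section koksma.
Variables (z : nat -> R) (N : nat).
Hypothesis z01 : forall n, 0 <= z n < 1.
Local Notation D := (discrepancy z N).

Let natr_count (a b : R) : ((\sum_(1 <= n < N.+1 | (a < z n < b)%R) 1)%N%:R : R)
  = \sum_(1 <= n < N.+1) (a < z n < b)%R%:R.
Proof.
rewrite natr_sum big_mkcond/=; apply: eq_bigr => n _.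
by case: (_ < _ < _)%R.
Qed.

Let sum1N : \sum_(1 <= n < N.+1) 1 = N%:R :> R.
Proof. by rewrite sumr_const_nat subn1. Qed.

Let count_bounds (a b : R) :
  0 <= (\sum_(1 <= n < N.+1) (a < z n < b)%R%:R : R) <= N%:R.
Proof.
rewrite sumr_ge0//= -sum1N ler_sum// => n _.
by case: (_ < _ < _)%R.
Qed.

Let local_le (a b : R) : 0 <= a -> a < b -> b <= 1 ->
  `|\sum_(1 <= n < N.+1) (a < z n < b)%R%:R - (b - a) * N%:R| <= N%:R.
Proof.
move=> a0 ab b1; have /andP[c0 cN] := count_bounds a b.
have : 0 <= (b - a) * N%:R <= N%:R by rewrite mulr_ge0 ?subr_ge0 ?(ltW ab)//= ler_piMl//; lra.
by move=> /andP[]; rewrite ler_norml; lra.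
Qed.

Let D_ub : has_ubound [set r | exists a b : R, [/\ 0 <= a, a < b, b <= 1 &
  r = `|(\sum_(1 <= n < N.+1 | (a < z n < b)%R) 1)%N%:R - (b - a) * N%:R|]].
Proof.
exists N%:R => _ [a [b [a0 ab b1 ->]]].
by rewrite natr_count local_le.
Qed.

Lemma interval_count_discrepancy (a b : R) : 0 <= a -> a < b -> b <= 1 ->
  `|\sum_(1 <= n < N.+1) (a < z n < b)%R%:R - (b - a) * N%:R| <= D.
Proof.
move=> a0 ab b1; apply: ub_le_sup D_ub _ _.
by exists a, b; split; rewrite ?natr_count.
Qed.

Lemma discrepancy_le : D <= N%:R.
Proof.
apply: ge_sup; first by eexists; exists 0, 1; split.
by move=> _ [a [b [a0 ab b1 ->]]]; rewrite natr_count local_le.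
Qed.

(** The intervals in the definition of the discrepancy are open, so the points
    equal to 0 have to be counted apart: there are [N] minus the number of
    points in [(0, 1)] of them, hence at most the discrepancy. *)
Lemma initial_count_discrepancy t : 0 < t <= 1 ->
  `|\sum_(1 <= n < N.+1) (z n < t)%R%:R - t * N%:R| <= 2 * D.
Proof.
move=> /andP[t0 t1].
have := interval_count_discrepancy (lexx 0) ltr01 (lexx 1).
have := interval_count_discrepancy (lexx 0) t0 t1.
rewrite !subr0 mul1r.
set c1 := \sum_(1 <= n < N.+1) (0 < z n < 1)%R%:R.
set ct := \sum_(1 <= n < N.+1) (0 < z n < t)%R%:R.
have -> : \sum_(1 <= n < N.+1) (z n < t)%R%:R = ct + N%:R - c1 :> R.
  rewrite /ct /c1 -sum1N -big_split -sumrB/=; apply: eq_bigr => n _.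
  have /andP[] := z01 n; rewrite le_eqVlt => /orP[/eqP<- _|-> ->] /=.
    by rewrite t0 ltxx/=; ring.
  by rewrite addrK.
by rewrite !ler_norml => /andP[? ?] /andP[? ?]; apply/andP; lra.
Qed.

(** Koksma's inequality for the cosine. On the grid of step [1 / K] the cosine
    is a combination of indicator functions of initial intervals, with the
    increments of the cosine as coefficients; each indicator contributes its
    count error, and the increments have total size at most [2 * pi]. The main
    terms add up to the sum of the cosine over all of the grid, which
    vanishes. *)
Lemma sum_tcos_discrepancy t :
  `|\sum_(1 <= n < N.+1) tcos (z n + t)| <= 4 * pi * D.
Proof.
have pi0 := @pi_gt0 R.
apply/ler_addgt0Pr => e e0.
pose K := (Num.truncn (2 * pi * N%:R / e)).+2.
have K0 : (K%:R : R) != 0 by rewrite pnatr_eq0.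
have Kgt0 : 0 < K%:R :> R by rewrite ltr0n.
pose F (j : nat) := tcos (t + 1%:R * j%:R / K%:R) : R.
pose idx n := Num.truncn (K%:R * z n).
have F_lip (j : nat) : `|F j.+1 - F j| <= 2 * pi / K%:R.
  apply: le_trans (tcos_lipschitz _ _) _.
  have -> : t + 1%:R * j.+1%:R / K%:R - (t + 1%:R * j%:R / K%:R) = K%:R^-1.
    by rewrite -natr1; field.
  by rewrite ger0_norm// invr_ge0.
have F_close n : `|tcos (z n + t) - F (idx n)| <= 2 * pi / K%:R.
  apply: le_trans (tcos_lipschitz _ _) _; rewrite ler_pM2l ?mulr_gt0//.
  have Kz0 : 0 <= K%:R * z n by rewrite mulr_ge0//; have /andP[] := z01 n.
  have := truncn_itv Kz0; rewrite -/(idx n) -natr1 => /andP[h1 h2].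
  have -> : z n + t - (t + 1%:R * (idx n)%:R / K%:R)
      = (K%:R * z n - (idx n)%:R) / K%:R by field.
  by rewrite ger0_norm ?divr_ge0 ?subr_ge0// ler_pdivrMr// mulVf//; lra.
have idx_lt n : (idx n < K)%N.
  have /andP[z0 z1] := z01 n.
  rewrite truncn_lt_nat ?mulr_ge0//.
  by rewrite gtr_pMr.
have F_step n : F (idx n) = F K -
    \sum_(0 <= j < K) (F j.+1 - F j) * (z n < j.+1%:R / K%:R)%R%:R.
  have -> : \sum_(0 <= j < K) (F j.+1 - F j) * (z n < j.+1%:R / K%:R)%R%:R
      = \sum_(0 <= j < K) (F j.+1 - F j) * (idx n <= j)%N%:R.
    apply: eq_bigr => j _; rewrite truncn_le_nat ltr_pdivlMr//.
    by rewrite (mulrC (z n)).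
  rewrite (@big_cat_nat _ _ _ (idx n) 0%N K)//= ?(ltnW (idx_lt n))//.
  rewrite big_nat big1 ?add0r; last first.
    by move=> j /andP[_ ji]; rewrite leqNgt ji mulr0.
  rewrite (@eq_big_nat _ _ _ _ _ _ (fun j => F j.+1 - F j)); last first.
    by move=> j /andP[ij _]; rewrite ij mulr1.
  by rewrite telescope_sumr ?(ltnW (idx_lt n))//; ring.
pose cnt (j : nat) : R := \sum_(1 <= n < N.+1) (z n < j.+1%:R / K%:R)%R%:R.
pose err (j : nat) : R := cnt j - j.+1%:R / K%:R * N%:R.
have abel m : \sum_(0 <= j < m) (F j.+1 - F j) * j.+1%:R
    = m%:R * F m - \sum_(0 <= j < m) F j.
  elim: m => [|m ih]; first by rewrite !big_geq// mul0r subr0.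
  by rewrite !big_nat_recr//= ih -natr1; ring.
(* The mean of the cosine over the grid is exactly 0, not just small. *)
have sumF0 : \sum_(0 <= j < K) F j = 0.
  by apply: tcos_sum_eq0 => //; rewrite dvdn1.
have sum_idx : \sum_(1 <= n < N.+1) F (idx n)
    = - \sum_(0 <= j < K) (F j.+1 - F j) * err j.
  rewrite (eq_bigr _ (fun n _ => F_step n)) sumrB.
  rewrite exchange_big/=.
  rewrite [X in _ - X](eq_bigr (fun j => (F j.+1 - F j) * cnt j)); last first.
    by move=> j _; rewrite mulr_sumr.
  rewrite [X in _ - X](eq_bigr (fun j =>
      (F j.+1 - F j) * err j + (F j.+1 - F j) * j.+1%:R * (N%:R / K%:R))).
    rewrite big_split/= -mulr_suml abel sumF0 subr0 sumr_const_nat subn1/=.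
    by rewrite -mulr_natr; field.
  by move=> j _; rewrite /err; field.
have bound_idx : `|\sum_(1 <= n < N.+1) F (idx n)| <= 4 * pi * D.
  rewrite sum_idx normrN; apply: le_trans (ler_norm_sum _ _ _) _.
  have -> : 4 * pi * D = \sum_(0 <= j < K) (2 * pi / K%:R) * (2 * D).
    by rewrite sumr_const_nat subn0 -mulr_natr; field.
  rewrite !big_nat; apply: ler_sum => j /andP[_ jK].
  rewrite normrM ler_pM// /err initial_count_discrepancy//.
  by rewrite divr_gt0 ?ltr0n//= ler_pdivrMr// mul1r ler_nat.
have -> : \sum_(1 <= n < N.+1) tcos (z n + t) = \sum_(1 <= n < N.+1) F (idx n)
    + \sum_(1 <= n < N.+1) (tcos (z n + t) - F (idx n)).
  by rewrite sumrB addrC subrK.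
apply: le_trans (ler_normD _ _) _; apply: lerD => //.
apply: le_trans (ler_norm_sum _ _ _) _.
apply: le_trans (ler_sum _ (fun n _ => F_close n)) _.
rewrite sumr_const_nat subn1/= -[_ *+ N]mulr_natr mulrAC ler_pdivrMr//.
rewrite -ler_pdivrMl// mulrC.
apply: ltW; apply: lt_trans (truncnS_gt _) _.
by rewrite /K ltr_nat.
Qed.

End koksma.

(** * Perturbed Gauss sums *)

Lemma sum_by_parts (u w : nat -> R) (N : nat) :
  \sum_(1 <= n < N.+2) u n * w n
  = (\sum_(1 <= n < N.+2) u n) * w N.+1
    - \sum_(1 <= n < N.+1) (\sum_(1 <= i < n.+1) u i) * (w n.+1 - w n).
Proof.
elim: N => [|N ih]; first by rewrite !big_nat1 big_geq// subr0.
rewrite big_nat_recr//= ih [in RHS]big_nat_recr//= [X in _ = _ - X]big_nat_recr//=.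
ring.
Qed.

Lemma norm_sum_by_parts (u w : nat -> R) (N : nat) (B W : R) : (0 < N)%N ->
  (forall n, (n <= N)%N -> `|\sum_(1 <= i < n.+1) u i| <= B) ->
  `|w N| + \sum_(1 <= n < N) `|w n.+1 - w n| <= W ->
  `|\sum_(1 <= n < N.+1) u n * w n| <= B * W.
Proof.
case: N => [//|N] _ uB wW.
have B0 : 0 <= B by have := uB 0%N isT; rewrite big_geq// normr0.
apply: le_trans (ler_wpM2l B0 wW); rewrite sum_by_parts mulrDr mulr_sumr.
apply: le_trans (ler_normB _ _) _; apply: lerD.
  by rewrite normrM ler_wpM2r// uB.
apply: le_trans (ler_norm_sum _ _ _) _.
rewrite !big_nat; apply: ler_sum => n /andP[_ nN].
by rewrite normrM ler_wpM2r// uB// ltnW.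
Qed.

Lemma tcosB x y : tcos (x - y) = tcos x * tcos y + tcos (x - 4^-1) * tcos (y - 4^-1).
Proof.
have q u : tcos (u - 4^-1) = sin (2 * pi * u).
  by rewrite -cosBpihalf; congr cos; field.
by rewrite !q mulrBr cosB.
Qed.

(** A slowly varying perturbation [g] can be removed at the cost of a constant
    factor. By the addition formula [cos (y - g)] splits into products of a
    trigonometric function of [y] and one of [g]; the latter has bounded
    variation, so a bound on all the initial sums suffices by summation by
    parts. *)
Lemma perturbed_tcos_sum (y g : nat -> R) (N : nat) (B V t : R) : (0 < N)%N ->
  (forall n s, (n <= N)%N -> `|\sum_(1 <= i < n.+1) tcos (y i + s)| <= B) ->
  (forall n, (0 < n)%N -> g n <= g n.+1) -> g N - g 1%N <= V ->
  `|\sum_(1 <= n < N.+1) tcos (y n - g n + t)| <= B * (2 * (1 + 2 * pi * V)).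
Proof.
move=> N0 yB g_nd gV.
have weight s : `|tcos (g N + s)| +
    \sum_(1 <= n < N) `|tcos (g n.+1 + s) - tcos (g n + s)| <= 1 + 2 * pi * V.
  apply: lerD; first exact: cos_max.
  have pi0 := @pi_gt0 R.
  have gV' : 2 * pi * (g N - g 1%N) <= 2 * pi * V by rewrite ler_pM2l ?mulr_gt0.
  apply: le_trans gV'; rewrite -telescope_sumr// mulr_sumr.
  rewrite !big_nat; apply: ler_sum => n /andP[n0 _].
  apply: le_trans (tcos_lipschitz _ _) _.
  by rewrite opprD addrACA subrr addr0 ger0_norm ?subr_ge0 ?g_nd.
have -> : \sum_(1 <= n < N.+1) tcos (y n - g n + t)
   = \sum_(1 <= n < N.+1) tcos (y n + t) * tcos (g n + 0)
   + \sum_(1 <= n < N.+1) tcos (y n + (t - 4^-1)) * tcos (g n - 4^-1).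
  rewrite -big_split/=; apply: eq_bigr => n _.
  by rewrite addrAC tcosB addr0 addrA.
apply: le_trans (ler_normD _ _) _.
have -> : B * (2 * (1 + 2 * pi * V)) = B * (1 + 2 * pi * V) + B * (1 + 2 * pi * V).
  by ring.
apply: lerD; apply: norm_sum_by_parts => //.
- by move=> n nN; exact: yB.
- by move=> n nN; exact: yB.
Qed.

Lemma sum_residues (F : nat -> R) (p V : nat) :
  \sum_(1 <= n < (p * V).+1) F n
  = \sum_(1 <= w < p.+1) \sum_(0 <= v < V) F (w + p * v)%N.
Proof.
rewrite exchange_big_nat/=; elim: V => [|V ih]; first by rewrite muln0 !big_geq.
rewrite [in RHS]big_nat_recr//= -ih mulnS addnC -addSn.
rewrite (@big_cat_nat _ _ _ (p * V).+1)//= ?leq_addr//; congr (_ + _).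
rewrite -{1}[(p * V).+1]add1n big_addn.
have -> : ((p * V).+1 + p - p * V = p.+1)%N by lia.
by apply: eq_bigr.
Qed.

(** Along a progression modulo [p] the phase [f] is linear modulo 1, with slope
    [j w / p], so that the sum over the progression vanishes unless [p] divides
    [j w]. Only the residue [w0] survives, and there all the terms are equal
    to 1. *)
Lemma complete_tcos_sum (f : nat -> R) (j : nat -> nat) (p V w0 : nat) :
  (0 < p)%N -> (p %| V)%N ->
  (forall w v, exists k : nat,
     f (w + p * v)%N = f w + (j w)%:R * v%:R / p%:R + k%:R) ->
  (0 < w0 <= p)%N -> (forall w, (0 < w <= p)%N -> (p %| j w)%N = (w == w0)) ->
  \sum_(1 <= n < (p * V).+1) tcos (f n - f w0) = V%:R.
Proof.
move=> p0 pV fE w0p jE.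
have p0' : (p%:R : R) != 0 by rewrite pnatr_eq0 -lt0n.
rewrite sum_residues (bigD1_seq w0)/= ?mem_index_iota ?iota_uniq//.
have -> : \sum_(0 <= v < V) tcos (f (w0 + p * v)%N - f w0) = V%:R.
  rewrite (eq_bigr (fun=> 1)); first by rewrite sumr_const_nat subn0.
  move=> v _; have [k ->] := fE w0 v.
  have := jE w0 w0p; rewrite eqxx => /dvdnP[m ->].
  have -> : f w0 + (m * p)%:R * v%:R / p%:R + k%:R - f w0 = 0 + (m * v + k)%:R.
    by rewrite natrD !natrM; field; exact: p0'.
  by rewrite tcosDn mulr0 cos0.
rewrite big_nat_cond big1 ?addr0// => w /andP[wp ww0].
rewrite -[RHS](@tcos_sum_eq0 (f w - f w0) (j w) p V)// ?jE//.
apply: eq_bigr => v _; have [k ->] := fE w v.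
by rewrite -[RHS](tcosDn _ k); congr cos; ring.
Qed.

Lemma linear_residue (p a b : nat) : (0 < p)%N -> coprime p a ->
  exists2 w0, (0 < w0 <= p)%N &
    forall w, (0 < w <= p)%N -> (p %| b + a * w)%N = (w == w0).
Proof.
move=> p0 pa.
pose h (i : 'I_p) : 'I_p := Ordinal (ltn_pmod (b + a * i.+1) p0).
have h_inj : injective h.
  move=> i k [/eqP]; rewrite eqn_modDl.
  wlog ik : i k / (i <= k)%N.
    move=> H; case: (leqP i k) => [/H//|/ltnW ki].
    by rewrite eq_sym => /(H _ _ ki).
  rewrite eq_sym eqn_mod_dvd ?leq_mul// -mulnBr Gauss_dvdr// subSS => pk.
  apply/val_inj/eqP; rewrite eqn_leq ik/= -subn_eq0; apply/eqP.
  case: (posnP (k - i)%N) => // ki0.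
  have := dvdn_leq ki0 pk; have := ltn_ord k; lia.
have [i hi] : exists i, h i = Ordinal p0.
  by have /injF_onto/(_ (Ordinal p0))/codomP[i ->] := h_inj; exists i.
exists i.+1; first exact: ltn_ord.
move=> w /andP[w0 wp].
case: w w0 wp => // w _ wp.
rewrite eqSS; apply/idP/eqP => [pw|->].
  suff : h (Ordinal wp) = h i by move/h_inj => <-.
  by rewrite hi; apply: val_inj; apply/eqP.
by move: hi => [/eqP].
Qed.

(** This is where a large discrepancy comes from. The exact rational phase with
    denominator [p ^ 2] has a trigonometric sum of size [V] at length [p * V],
    by [complete_tcos_sum]: expanding the square at [w + p * v] leaves the slope
    [(b + 2 * a * w) / p] in [v]. If all the discrepancies up to that length
    were small, then by Koksma all the initial sums of the perturbed sequence
    would be small, and removing the perturbation would make the rational sum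
    small too. It is essential to use all the lengths up to [p * V] at once:
    in this way no estimate of incomplete rational sums is needed. *)
Lemma quadratic_discrepancy (p V a b : nat) (h y : nat -> R) (d1 d2 : R) :
  (0 < p)%N -> (0 < V)%N -> (p %| V)%N -> coprime p (2 * a) ->
  (forall w v, exists k : nat, h (w + p * v)%N = h w + k%:R) ->
  0 <= d1 <= (p * V)%:R^-1 -> 0 <= d2 <= (p * V)%:R^-1 ^+ 2 ->
  (forall n, y n = b%:R * n%:R / p%:R ^+ 2 + a%:R * n%:R ^+ 2 / p%:R ^+ 2 + h n
                 + (d1 * n%:R + d2 * n%:R ^+ 2)) ->
  exists2 n, (n <= p * V)%N &
    V%:R <= 16 * pi * (1 + 4 * pi) * discrepancy (frac_part \o y) n.
Proof.
move=> p0 V0 pV pa hp /andP[d10 d11] /andP[d20 d21] yE.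
have p0' : (p%:R : R) != 0 by rewrite pnatr_eq0 -lt0n.
have pi0 := @pi_gt0 R.
set C := 16 * pi * (1 + 4 * pi).
have C0 : 0 < C by rewrite !mulr_gt0// addr_gt0// mulr_gt0.
apply: contrapT => noN.
have small n : (n <= p * V)%N -> discrepancy (frac_part \o y) n <= V%:R / C.
  move=> nN; rewrite leNgt; apply/negP => large; apply: noN; exists n => //.
  by rewrite -ler_pdivrMl// mulrC ltW.
pose f n := b%:R * n%:R / p%:R ^+ 2 + a%:R * n%:R ^+ 2 / p%:R ^+ 2 + h n : R.
pose g n := d1 * n%:R + d2 * n%:R ^+ 2 : R.
have [w0 w0p w0E] := linear_residue b p0 pa.
have f_block w v : exists k : nat,
    f (w + p * v)%N = f w + (b + 2 * a * w)%:R * v%:R / p%:R + k%:R.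
  have [k kE] := hp w v; exists (a * v ^ 2 + k)%N; rewrite /f kE !natrD !natrM ?natrX.
  by field; exact: p0'.
have main := complete_tcos_sum p0 pV f_block w0p w0E.
have z01 n : 0 <= (frac_part \o y) n < 1 by exact: frac_part_itv.
have partial n s : (n <= p * V)%N ->
    `|\sum_(1 <= i < n.+1) tcos (y i + s)| <= 4 * pi * (V%:R / C).
  move=> nN; have := sum_tcos_discrepancy n z01 s.
  have -> : \sum_(1 <= i < n.+1) tcos ((frac_part \o y) i + s)
      = \sum_(1 <= i < n.+1) tcos (y i + s).
    apply: eq_bigr => i _; rewrite /= /frac_part.
    by rewrite -[LHS](tcosDz _ (Num.floor (y i))); congr cos; ring.
  move=> /le_trans; apply; rewrite ler_pM2l ?mulr_gt0//; exact: small.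
have N0 : (0 < p * V)%N by rewrite muln_gt0 p0.
have N0' : 0 < (p * V)%:R :> R by rewrite ltr0n.
have g_nd n : (0 < n)%N -> g n <= g n.+1.
  move=> _; rewrite /g -natr1; have : 0 <= d2 * n%:R by rewrite mulr_ge0.
  lra.
have g_var : g (p * V)%N - g 1%N <= 2.
  have g1 : 0 <= g 1%N by rewrite /g; lra.
  have e1 : d1 * (p * V)%:R <= 1 by rewrite -ler_pdivlMr// mul1r.
  have e2 : d2 * (p * V)%:R ^+ 2 <= 1.
    by rewrite -ler_pdivlMr ?exprn_gt0// mul1r -exprVn.
  by rewrite /g in g1 *; lra.
have := perturbed_tcos_sum (- f w0) N0 partial g_nd g_var.
rewrite (eq_bigr (fun n => tcos (f n - f w0))); last first.
  by move=> n _; congr cos; rewrite yE /f /g; ring.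
rewrite main ger0_norm//.
have -> : 4 * pi * (V%:R / C) * (2 * (1 + 2 * pi * 2)) = V%:R / 2.
  rewrite /C; move: (@pi R) pi0 => P P0; field.
  by rewrite !gt_eqF// addr_gt0// !mulr_gt0.
have : 0 < V%:R :> R by rewrite ltr0n.
lra.
Qed.
End trigonometric_sums.

(** * The mass distribution principle *)

Section mass_distribution.
Context {R : realType} {d : nat}.
Implicit Types (U V A : set 'rV[R]_d) (x y : 'rV[R]_d).

Lemma coord_le_eucl_dist x y i : `|x 0 i - y 0 i| <= eucl_dist x y.
Proof.
rewrite -sqrtr_sqr /eucl_dist ler_wsqrtr// (bigD1 i)//= lerDl.
by apply: sumr_ge0 => j _; exact: sqr_ge0.
Qed.

Lemma diam_ge0 U : (0 <= diam U)%E.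
Proof. by rewrite /diam le_max lexx. Qed.

Lemma coord_le_diam U x y i (r : R) : (diam U <= r%:E)%E -> U x -> U y ->
  `|x 0 i - y 0 i| <= r.
Proof.
move=> Ur Ux Uy; rewrite -lee_fin; apply: le_trans Ur.
rewrite /diam le_max; apply/orP; right.
apply: (@le_trans _ _ (eucl_dist x y)%:E); first by rewrite lee_fin coord_le_eucl_dist.
by apply: ereal_sup_ubound; exists (x, y).
Qed.

Lemma open_thickening U (e : R) : 0 < e -> exists V, [/\ open V, U `<=` V &
  forall x y i (r : R), (diam U <= r%:E)%E -> V x -> V y ->
    `|x 0 i - y 0 i| <= r + 2 * e].
Proof.
move=> e0; exists (\bigcup_(x in U) (ball x e)°); split.
- by apply: bigcup_open => x _; exact: open_interior.
- move=> x Ux; exists x => //.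
  exact: nbhs_singleton (nbhs_interior (nbhsx_ballx _ _ _)).
move=> x y i r Ur [x' Ux' /interior_subset[_ xx']] [y' Uy' /interior_subset[_ yy']].
have := coord_le_diam i Ur Ux' Uy'.
move: (xx' 0 i) (yy' 0 i); rewrite /ball/= !ltr_distl !ler_norml.
by move=> /andP[? ?] /andP[? ?] /andP[? ?]; apply/andP; split; lra.
Qed.

Lemma nested_subset (T : nat -> set 'rV[R]_d) : (forall n, T n.+1 `<=` T n) ->
  forall m n, (m <= n)%N -> T n `<=` T m.
Proof.
move=> decT m n /subnK <-; elim: (n - m)%N => // k ih.
exact: subset_trans (decT _) ih.
Qed.

(** The complements of the [T n] together with the [V n] cover [T 0]; the finite
    subcover has a last index, and its union is increasing in that index. *)
Lemma nested_compact_cover (T V : nat -> set 'rV[R]_d) :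
  (forall n, compact (T n)) -> (forall n, T n.+1 `<=` T n) ->
  (forall n, open (V n)) -> \bigcap_n T n `<=` \bigcup_n V n ->
  exists n, T n `<=` \bigcup_(k < n) V k.
Proof.
move=> cT decT oV TV.
have decT' := nested_subset decT.
have clT n : closed (T n) by exact: compact_closed (@norm_hausdorff _ _) (cT n).
pose O n := (\bigcup_(k < n) V k) `|` ~` T n.
have oO n : open (O n).
  apply: openU; first by apply: bigcup_open => k _.
  by rewrite openC.
have := cT 0%N; rewrite compact_cover => /(_ nat setT O (fun n _ => oO n)).
case.
  move=> x _; have [/TV[k _ Vx]|] := pselect ((\bigcap_n T n) x).
    by exists k.+1 => //; left; exists k => /=.
  rewrite -[(\bigcap_n T n) x]/((\bigcap_(n in setT) T n) x).
  move=> /existsNP[n /not_implyP[_ nT]].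
  by exists n => //; right.
move=> D _ TO; exists (\max_(k <- finmap.enum_fset D) k)%N => x Tx.
have /TO[k kD] : T 0%N x by exact: decT' Tx.
have kmax : (k <= \max_(k <- finmap.enum_fset D) k)%N.
  by apply: (@leq_bigmax_seq _ _ (fun=> true) (fun k => k)).
move=> [[j jk Vx]|]; first by exists j => //=; exact: leq_trans jk kmax.
by move=> /(_ (decT' _ _ kmax _ Tx)).
Qed.

Lemma size_le_sum_count (P : seq 'rV[R]_d) (n : nat) (V : nat -> set 'rV[R]_d) :
  (forall x, x \in P -> (\bigcup_(k < n) V k) x) ->
  (size P <= \sum_(k < n) count (fun x => `[< V k x >]) P)%N.
Proof.
elim: P => [//|x P ih] PV /=; rewrite big_split/= -add1n leq_add//; last first.
  by apply: ih => y yP; apply: PV; rewrite inE yP orbT.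
have [k kn Vx] := PV x (mem_head _ _).
by rewrite (bigD1 (Ordinal kn))//= asboolT.
Qed.

(** The mass distribution principle, in a form without measures: the mass is the
    normalized counting measure on the finite sets [P n], and only its bound on
    sets of size [r] at late stages [n] matters. A cover with a small sum of the
    [s]-th powers of the diameters can be thickened to an open one, and then by
    compactness finitely many of its members cover a whole stage [T n], so that
    the points of [P n] in them, too few by the bound, would have to be all the
    points of [P n]. *)
Lemma mass_distribution (s C : R) (T : nat -> set 'rV[R]_d)
    (P : nat -> seq 'rV[R]_d) A :
  0 < s -> 0 < C ->
  (forall n, compact (T n)) -> (forall n, T n.+1 `<=` T n) ->
  (forall n, (0 < size (P n))%N) -> (forall n x, x \in P n -> T n x) ->
  (forall r, 0 < r <= 1 -> exists n0, forall n, (n0 <= n)%N -> forall V,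
     (forall x y i, V x -> V y -> `|x 0 i - y 0 i| <= r) ->
     (count (fun x => `[< V x >]) (P n))%:R <= C * r `^ s * (size (P n))%:R) ->
  \bigcap_n T n `<=` A ->
  hausdorff_measure s A <> 0%E.
Proof.
move=> s0 C0 cT decT P0 PT PV TA HA.
pose h : R := 2^-1.
have h0 : 0 < h by rewrite invr_gt0.
pose eta := Num.min (h `^ s) (4 * C * 2 `^ s)^-1.
have two_s : 0 < 2 `^ s :> R by rewrite powR_gt0.
have C2 : 0 < 4 * C * 2 `^ s by rewrite !mulr_gt0.
have eta0 : 0 < eta by rewrite lt_min powR_gt0//= invr_gt0.
have : (hausdorff_premeasure s h A < eta%:E)%E.
  apply: (@le_lt_trans _ _ 0%E); last by rewrite lte_fin.
  by rewrite -HA; apply: ereal_sup_ubound; exists h.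
move=> /ereal_inf_lt[_ [U [AU Uh] <-] sumU].
pose D k := fine (diam (U k)).
have DE k : (diam (U k) = (D k)%:E)%E.
  rewrite /D fineK// fin_numE; have := Uh k; have := diam_ge0 (U k).
  by case: (diam (U k)).
have D0 k : 0 <= D k by rewrite /D fine_ge0// diam_ge0.
have Dh k : D k <= h by rewrite -lee_fin -DE.
(* The k-th set is thickened by e k / 2, where the s-th powers w k of the e k
   have a sum of at most eta. *)
pose w k : R := eta / 2 ^+ k.+1.
have w0 k : 0 < w k by rewrite divr_gt0// exprn_gt0.
pose e k := w k `^ s^-1.
have e0 k : 0 < e k by rewrite powR_gt0.
have es k : e k `^ s = w k by rewrite /e -powRrM mulVf ?gt_eqF// powRr1// ltW.
have eh k : e k <= h.
  have wh : w k <= h `^ s.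
    apply: (@le_trans _ _ eta); last by rewrite ge_min lexx.
    by rewrite ler_pdivrMr ?exprn_gt0// ler_peMr ?(ltW eta0)// exprn_ege1// ler1n.
  have -> : h = (h `^ s) `^ s^-1 by rewrite -powRrM mulfV ?gt_eqF// powRr1// ltW.
  by apply: ge0_ler_powR => //; rewrite ?nnegrE ?invr_ge0 ?ltW// powR_gt0.
have /choice[V VP] k := open_thickening (U k) (divr_gt0 (e0 k) (ltr0Sn R 1)).
pose r k := D k + e k.
have r01 k : 0 < r k <= 1.
  by rewrite /r ltr_wpDl//=; have := Dh k; have := eh k; rewrite /h; lra.
(* A sum is at most twice its larger term, whether s is below or above 1. *)
have rs k : r k `^ s <= 2 `^ s * (D k `^ s + w k).
  have [m [m0 rm ms]] : exists m, [/\ 0 <= m, r k <= 2 * m & m `^ s <= D k `^ s + w k].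
    have [De|/ltW eD] := leP (D k) (e k); [exists (e k)|exists (D k)]; split => //.
    - exact: ltW.
    - by rewrite /r; lra.
    - by rewrite es lerDr powR_ge0.
    - by rewrite /r; lra.
    - by rewrite lerDl ltW.
  apply: le_trans (ler_wpM2l (ltW two_s) ms); rewrite -powRM//.
  apply: ge0_ler_powR; rewrite ?nnegrE ?(ltW s0)//.
  - by have /andP[/ltW] := r01 k.
  - by rewrite mulr_ge0.
have [n TV] : exists n, T n `<=` \bigcup_(k < n) V k.
  apply: nested_compact_cover => // [k|x /TA /AU[k _ Ux]]; first by have [] := VP k.
  by exists k => //; have [_ + _] := VP k; apply.
have /choice[n0 n0P] k := PV _ (r01 k).
pose m := maxn n (\max_(k < n) n0 k).
have decT' := nested_subset decT.
have sizeP : (size (P m) <= \sum_(k < n) count (fun x => `[< V k x >]) (P m))%N.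
  apply: size_le_sum_count => x /PT Tx; apply: TV; exact: (decT' _ _ (leq_maxl _ _) _ Tx).
have bound k : (k < n)%N ->
    (count (fun x => `[< V k x >]) (P m))%:R <= C * r k `^ s * (size (P m))%:R.
  move=> kn; apply: n0P; first by rewrite /m leq_max (leq_bigmax (Ordinal kn)) orbT.
  move=> x y i Vx Vy; have [_ _ /(_ x y i (D k))] := VP k.
  have -> : D k + 2 * (e k / 2) = r k by rewrite /r; field.
  by apply => //; rewrite DE.
have sumD : \sum_(k < n) D k `^ s <= eta.
  rewrite -lee_fin; apply: le_trans (ltW sumU).
  rewrite -sumEFin -(big_mkord xpredT (fun k => (D k `^ s)%:E)).
  apply: nneseries_lim_ge => k _ _; by rewrite lee_fin powR_ge0.
have sumw : \sum_(k < n) w k <= eta.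
  have -> : \sum_(k < n) w k = eta * (1 - 2 ^- n).
    elim: (n) => [|k ih]; first by rewrite big_ord0 expr0 invr1 subrr mulr0.
    by rewrite big_ord_recr/= ih /w exprS; field; rewrite expf_neq0.
  by rewrite ler_piMr ?(ltW eta0)// gerBl invr_ge0 exprn_ge0.
have : (size (P m))%:R <= (C * (2 `^ s * (2 * eta))) * (size (P m))%:R :> R.
  have /le_trans : (size (P m))%:R <= \sum_(k < n) C * r k `^ s * (size (P m))%:R :> R.
    apply: (@le_trans _ _ (\sum_(k < n) count (fun x => `[< V k x >]) (P m))%N%:R).
      by rewrite ler_nat.
    by rewrite natr_sum; apply: ler_sum => k _; exact: bound.
  apply; rewrite -mulr_suml ler_wpM2r// -mulr_sumr ler_wpM2l ?(ltW C0)//.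
  apply: (@le_trans _ _ (\sum_(k < n) 2 `^ s * (D k `^ s + w k))).
    by apply: ler_sum => k _; exact: rs.
  by rewrite -mulr_sumr ler_wpM2l ?(ltW two_s)// big_split/= mulr2n mulrDl mul1r lerD.
rewrite leNgt => /negP; apply; rewrite gtr_pMl ?ltr0n//.
have : eta * (4 * C * 2 `^ s) <= 1.
  by rewrite -ler_pdivlMr// mul1r ge_min lexx orbT.
lra.
Qed.

End mass_distribution.

(** * Numbers with restricted base-3 digits *)

(** The [m] such that [m / 3 ^ j] has a base-3 expansion of length [j] whose
    [i]-th digit after the point, counted from 0, belongs to [dig i]. *)
Fixpoint numerators (dig : nat -> seq nat) (j : nat) : seq nat :=
  if j is i.+1 then [seq (3 * m + c)%N | m <- numerators dig i, c <- dig i]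
  else [:: 0%N].

Section numerators.
Variable dig : nat -> seq nat.
Local Notation L := (numerators dig).
Local Open Scope nat_scope.

Lemma numeratorsS_P j m : reflect (exists m' c, [/\ m' \in L j, c \in dig j & m = 3 * m' + c])
  (m \in L j.+1).
Proof.
apply: (iffP allpairsP) => [[[m' c] /= [? ? ->]]|[m' [c [? ? ->]]]].
  by exists m', c.
by exists (m', c).
Qed.

Lemma size_numeratorsS j : size (L j.+1) = size (L j) * size (dig j).
Proof. by rewrite /= size_allpairs. Qed.

Hypothesis dig_lt3 : forall j c, c \in dig j -> c < 3.

Lemma numerators_zero_run a b m : a <= b -> (forall i, a <= i < b -> dig i = [:: 0]) ->
  m \in L b -> exists2 m', m' \in L a & m = 3 ^ (b - a) * m'.
Proof.
move=> ab; rewrite -{1 2}(subnK ab); elim: (b - a) m => [|n ih] m zero.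
  by rewrite add0n => mL; exists m; rewrite ?mul1n.
rewrite addSn => /numeratorsS_P[m' [c [m'L + ->]]].
rewrite zero; last by rewrite leq_addl/= addSn.
rewrite inE => /eqP->; have [i /andP[ai ib]|m'' m''L ->] := ih m' _ m'L.
  by apply: zero; rewrite ai addSn ltnS ltnW.
by exists m'' => //; rewrite addn0 expnS mulnA.
Qed.

Hypothesis dig_uniq : forall j, uniq (dig j).

Lemma numerators_uniq j : uniq (L j).
Proof.
elim: j => [//|j ih]; apply: allpairs_uniq => // -[m c] [m' c'].
move=> /allpairsP[[? ?] [_ /= /dig_lt3 c3 [-> ->]]].
move=> /allpairsP[[? ?] [_ /= /dig_lt3 c'3 [-> ->]]] /= E.
by congr (_, _); lia.
Qed.

(** Each expansion of length [j] has the same number of extensions to length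
    [J]. *)
Lemma count_numerators_prefix J j k : j <= J ->
  count (fun m => m %/ 3 ^ (J - j) == k) (L J) * size (L j) <= size (L J).
Proof.
move=> jJ; rewrite -{2 3}(subnK jJ); elim: (J - j) => [|n ih].
  rewrite add0n -[leqRHS]mul1n leq_mul2r; apply/orP; right.
  rewrite (eq_count (a2 := pred1 k)); last by move=> m; rewrite /= divn1.
  by rewrite count_uniq_mem ?leq_b1// numerators_uniq.
rewrite addSn size_numeratorsS.
suff -> : count (fun m => m %/ 3 ^ n.+1 == k) (L (n + j).+1)
    = count (fun m => m %/ 3 ^ n == k) (L (n + j)) * size (dig (n + j)).
  by rewrite mulnAC leq_mul2r ih orbT.
have dl := @dig_lt3 (n + j).
rewrite /=; elim: (L _) => //= m s IH.
rewrite count_cat IH mulnDl; congr addn; rewrite count_map.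
rewrite (eq_in_count (a2 := fun=> m %/ 3 ^ n == k)); last first.
  move=> c /dl c3 /=.
  by rewrite expnS divnMA (mulnC 3) divnMDl// (divn_small c3) addn0.
by case: (_ == k); rewrite ?count_predT ?count_pred0 ?mul1n.
Qed.

(** Numbers within [K * 3 ^ - j] of each other have at most [2 * K + 1] different
    prefixes of length [j]. *)
Lemma count_numerators_close J j K (S : pred nat) : j <= J ->
  (forall m m', S m -> S m' -> m <= m' + K * 3 ^ (J - j)) ->
  count S (L J) * size (L j) <= (2 * K + 1) * size (L J).
Proof.
move=> jJ close; have b0 : 0 < 3 ^ (J - j) by rewrite expn_gt0.
have [/hasP[m1 _ Sm1]|] := boolP (has S (L J)); last first.
  by rewrite has_count -eqn0Ngt => /eqP->.
have prefix m : S m -> m %/ 3 ^ (J - j) <= m1 %/ 3 ^ (J - j) + K /\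
    m1 %/ 3 ^ (J - j) <= m %/ 3 ^ (J - j) + K.
  move=> Sm; rewrite -!divnDMl//; split; apply: leq_div2r; exact: close.
set k1 := m1 %/ _ in prefix.
have : count S (L J) <=
    \sum_(i < 2 * K + 1) count (fun m => m %/ 3 ^ (J - j) == k1 + i - K) (L J).
  elim: (L J) => [//|m s IH]; rewrite /= big_split/= leq_add//.
  case: (boolP (S m)) => // /prefix[].
  move: (m %/ _) => t tk kt.
  have im : t + K - k1 < 2 * K + 1 by rewrite ltn_subLR; lia.
  rewrite (bigD1 (Ordinal im))//=.
  have -> : t == k1 + (t + K - k1) - K by rewrite subnKC// addnK.
  exact: leq_addr.
move=> /leq_mul/(_ (leqnn (size (L j))))/leq_trans; apply.
rewrite big_distrl/=.
apply: (@leq_trans (\sum_(i < 2 * K + 1) size (L J))).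
  by apply: leq_sum => i _; exact: count_numerators_prefix.
by rewrite sum_nat_const card_ord.
Qed.

Hypothesis dig_gt0 : forall j, 0 < size (dig j).

Lemma leq_size_numerators i j : i <= j -> size (L i) <= size (L j).
Proof.
move=> /subnK <-; elim: (j - i) => // n ih; rewrite addSn size_numeratorsS.
by apply: leq_trans ih _; rewrite leq_pmulr.
Qed.

Lemma size_numerators_free i j :
  i <= j -> (forall k, i <= k < j -> size (dig k) = 3) ->
  size (L j) = 3 ^ (j - i) * size (L i).
Proof.
move=> ij; rewrite -{1 2}(subnK ij); elim: (j - i) => [|n ih] free.
  by rewrite mul1n.
rewrite addSn size_numeratorsS ih.
  by rewrite free ?expnS 1?mulnAC ?(mulnC 3)// leq_addl addSn ltnSn.
by move=> k /andP[ik kj]; apply: free; rewrite ik addSn ltnS ltnW.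
Qed.

End numerators.

Lemma count_allpairs_le (A B C : Type) (f : A -> B -> C) (a : pred C) (p : pred A)
    (q : pred B) (s : seq A) (t : seq B) :
  (forall x y, a (f x y) -> p x && q y) ->
  (count a [seq f x y | x <- s, y <- t] <= count p s * count q t)%N.
Proof.
move=> apq; elim: s => [//|x s ih] /=; rewrite count_cat mulnDl leq_add//.
rewrite count_map; have [px|px] := boolP (p x).
  by rewrite mul1n; apply: sub_count => y /= /apq/andP[].
rewrite (eq_count (a2 := pred0)) ?count_pred0// => y /=.
by apply/negP => /apq/andP[]; rewrite (negbTE px).
Qed.

(** * Products of two Cantor sets *)

Lemma triadic_scale (R : realType) (r : R) : 0 < r <= 1 ->
  exists j, 3 ^- j.+1 < r <= 3 ^- j.
Proof.
move=> /andP[r0 r1].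
have small : exists n, 3 ^- n < r.
  exists (Num.truncn r^-1).+1; rewrite invf_plt ?posrE ?exprn_gt0//.
  apply: lt_le_trans (truncnS_gt _) _.
  by rewrite -natrX ler_nat ltnW// ltn_expl.
case: (ex_minnP small) => -[|j] jr jmin.
  by move: jr; rewrite expr0 invr1 ltNge r1.
exists j; rewrite jr/= leNgt; apply/negP => /jmin; rewrite ltnn//.
Qed.

Section cantor_dust.
Context {R : realType} {d : nat}.
Variables (c : 'I_d.+2 -> nat) (J0 : nat) (dig0 dig1 : nat -> seq nat).
Hypothesis dig0_lt3 : forall j e, e \in dig0 j -> (e < 3)%N.
Hypothesis dig1_lt3 : forall j e, e \in dig1 j -> (e < 3)%N.
Hypothesis dig0_uniq : forall j, uniq (dig0 j).
Hypothesis dig1_uniq : forall j, uniq (dig1 j).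
Hypothesis dig0_gt0 : forall j, (0 < size (dig0 j))%N.
Hypothesis dig1_gt0 : forall j, (0 < size (dig1 j))%N.
Local Notation L0 := (numerators dig0).
Local Notation L1 := (numerators dig1).

Definition free_coord (m0 m1 : nat) (i : 'I_d.+2) : nat :=
  if i == 0 :> nat then m0 else if i == 1%N :> nat then m1 else 0%N.

Definition corner J (m0 m1 : nat) : 'rV[R]_d.+2 :=
  \row_i (((c i)%:R + (free_coord m0 m1 i)%:R / 3 ^+ J) / 3 ^+ J0).

(** The other coordinates get edges of length 0, which makes them constant on
    every stage. *)
Definition edge J (i : 'I_d.+2) : R := (i < 2)%N%:R / 3 ^+ J / 3 ^+ J0.

(** The union of the boxes of level [J] that approximate the set of the points of
    the cube with lower corner [c / 3 ^ J0] and side [3 ^ - J0] whose first two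
    coordinates have their digits in [dig0] and [dig1], and whose other
    coordinates are those of the corner. *)
Definition cantor_stage J : set 'rV[R]_d.+2 :=
  [set x | exists m0 m1, [/\ m0 \in L0 J, m1 \in L1 J &
    forall i, corner J m0 m1 0 i <= x 0 i <= corner J m0 m1 0 i + edge J i]].

Definition corners J : seq 'rV[R]_d.+2 :=
  [seq corner J m0 m1 | m0 <- L0 J, m1 <- L1 J].

Let pow3_gt0 n : 0 < 3 ^+ n :> R. Proof. exact: exprn_gt0. Qed.
Let pow3_neq0 n : 3 ^+ n != 0 :> R. Proof. by rewrite gt_eqF. Qed.

Lemma cantor_stage_compact J : compact (cantor_stage J).
Proof.
pose box (p : nat * nat) := [set x : 'rV[R]_d.+2 | forall i,
  `[corner J p.1 p.2 0 i, corner J p.1 p.2 0 i + edge J i]%classic (x 0 i)].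
have -> : cantor_stage J =
    \big[setU/set0]_(p <- [seq (m0, m1) | m0 <- L0 J, m1 <- L1 J]) box p.
  rewrite -bigcup_seq; apply/seteqP; split=> [x [m0 [m1 [m0L m1L xbox]]]|x].
    exists (m0, m1); first by apply/allpairsP; exists (m0, m1).
    by move=> i; rewrite /= in_itv/= xbox.
  move=> [_ /= /allpairsP[[m0 m1] /= [m0L m1L ->]] xbox].
  by exists m0, m1; split=> // i; have := xbox i; rewrite /= in_itv.
apply: bigsetU_compact => p _.
pose side (i : 'I_d.+2) : set R :=
  `[corner J p.1 p.2 0 i, corner J p.1 p.2 0 i + edge J i]%classic.
have side_compact i : compact (side i) by exact: segment_compact.
exact: rV_compact side_compact.
Qed.

Lemma cantor_stageS J : cantor_stage J.+1 `<=` cantor_stage J.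
Proof.
move=> x [_ [_ [/numeratorsS_P[m0 [e0 [m0L /dig0_lt3 e03 ->]]]
  /numeratorsS_P[m1 [e1 [m1L /dig1_lt3 e13 ->]]] xbox]]].
exists m0, m1; split=> // i; have := xbox i.
rewrite !mxE /edge -!mulrDl -!addrA -!mulrDl ler_pdivrMr// ler_pdivlMr//.
rewrite ler_pdivrMr// ler_pdivlMr//.
set t := x 0 i * _ => /andP[tlo thi].
have [e e3 eE] : exists2 e, (e + (i < 2) <= 3 * (i < 2))%N &
    free_coord (3 * m0 + e0) (3 * m1 + e1) i = (3 * free_coord m0 m1 i + e)%N.
  rewrite /free_coord; case: eqP => [->|_]; first by exists e0 => //; lia.
  case: eqP => [->|_]; first by exists e1 => //; lia.
  by exists 0%N; rewrite ?muln0 // add0n; case: (i < 2)%N.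
rewrite eE in tlo thi.
have scale (u : R) : u / 3 ^+ J = (3 * u) / 3 ^+ J.+1.
  by rewrite exprS; field; exact: pow3_neq0.
rewrite !scale; apply/andP; split.
  apply: le_trans tlo; rewrite lerD2l ler_pM2r ?invr_gt0// -natrM ler_nat.
  exact: leq_addr.
apply: (le_trans thi); rewrite lerD2l ler_pM2r ?invr_gt0//.
by rewrite -!natrD -natrM ler_nat; lia.
Qed.

Lemma corners_stage J x : x \in corners J -> cantor_stage J x.
Proof.
move=> /allpairsP[[m0 m1] /= [m0L m1L ->]]; exists m0, m1; split=> // i.
by rewrite lexx/= lerDl !divr_ge0// exprn_ge0.
Qed.

Lemma size_numerators_gt0 (dig : nat -> seq nat) J :
  (forall j, (0 < size (dig j))%N) -> (0 < size (numerators dig J))%N.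
Proof. by move=> pos; elim: J => // J ih; rewrite size_numeratorsS muln_gt0 ih pos. Qed.

(** A set of size [3 ^ - j] meets a bounded number of triadic intervals of level
    [j] in either coordinate, and each of them holds the same share of the
    corners. *)
Lemma count_corners J j (r : R) (V : set 'rV[R]_d.+2) : (j <= J)%N -> r <= 3 ^- j ->
  (forall x y i, V x -> V y -> `|x 0 i - y 0 i| <= r) ->
  (count (fun x => `[< V x >]) (corners J) * (size (L0 j) * size (L1 j))
    <= (2 * 3 ^ J0 + 1) ^ 2 * size (corners J))%N.
Proof.
move=> jJ rj Vr.
pose S0 m0 := `[< exists m1, V (corner J m0 m1) >].
pose S1 m1 := `[< exists m0, V (corner J m0 m1) >].
have close (m m' : nat) (i : 'I_d.+2) (a b a' b' : nat) :
    V (corner J a b) -> V (corner J a' b') ->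
    free_coord a b i = m -> free_coord a' b' i = m' ->
    (m <= m' + 3 ^ J0 * 3 ^ (J - j))%N.
  move=> Va Vb <- <-; have := le_trans (Vr _ _ i Va Vb) rj.
  rewrite !mxE => /(le_trans (ler_norm _)).
  set u := free_coord a b i; set v := free_coord a' b' i.
  rewrite -mulrBl opprD addrACA subrr add0r -mulrBl ler_pdivrMr// ler_pdivrMr// => uv.
  rewrite -(ler_nat R) natrD natrM !natrX -lerBlDl.
  apply: le_trans uv _; rewrite -{1}(subnK jJ) exprD.
  suff -> : 3 ^- j * 3 ^+ J0 * (3 ^+ (J - j) * 3 ^+ j) = 3 ^+ J0 * 3 ^+ (J - j) :> R by [].
  by field; exact: pow3_neq0.
have h0 := @count_numerators_close _ dig0_lt3 dig0_uniq J j (3 ^ J0) S0 jJ.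
have h1 := @count_numerators_close _ dig1_lt3 dig1_uniq J j (3 ^ J0) S1 jJ.
have {}h0 : (count S0 (L0 J) * size (L0 j) <= (2 * 3 ^ J0 + 1) * size (L0 J))%N.
  apply: h0 => m m' /asboolP[b Vb] /asboolP[b' Vb'].
  exact: (close _ _ ord0 _ _ _ _ Vb Vb').
have {}h1 : (count S1 (L1 J) * size (L1 j) <= (2 * 3 ^ J0 + 1) * size (L1 J))%N.
  apply: h1 => m m' /asboolP[b Vb] /asboolP[b' Vb'].
  exact: (close _ _ (lift ord0 ord0) _ _ _ _ Vb Vb').
have cnt : (count (fun x => `[< V x >]) (corners J) <= count S0 (L0 J) * count S1 (L1 J))%N.
  apply: count_allpairs_le => m0 m1 /asboolP V01.
  by apply/andP; split; apply/asboolP; [exists m1|exists m0].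
rewrite size_allpairs; apply: leq_trans (leq_mul cnt (leqnn _)) _.
by rewrite mulnACA expnS expn1 [leqRHS]mulnACA leq_mul.
Qed.

(** The dimension is at least [s] as soon as the number of pairs of expansions of
    length [j] is at least of order [3 ^ (s * j)] for every [j], not only on
    average. *)
Lemma cantor_dust_measure (s C1 : R) (A : set 'rV[R]_d.+2) : 0 < s -> 0 < C1 ->
  (forall j, 3 `^ (s * j%:R) <= C1 * (size (L0 j) * size (L1 j))%:R) ->
  \bigcap_J cantor_stage J `<=` A -> hausdorff_measure s A <> 0%E.
Proof.
move=> s0 C10 growth stageA.
pose K : R := ((2 * 3 ^ J0 + 1) ^ 2)%N%:R.
have K0 : 0 < K by rewrite ltr0n expn_gt0 addn1.
apply: (@mass_distribution _ _ s (K * C1 * 3 `^ s) cantor_stage corners) => //.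
- by rewrite !mulr_gt0 ?powR_gt0.
- exact: cantor_stage_compact.
- exact: cantor_stageS.
- by move=> J; rewrite size_allpairs muln_gt0 !size_numerators_gt0.
- exact: corners_stage.
move=> r r01; have [j /andP[jr rj]] := triadic_scale r01.
exists j => J jJ V Vr.
have r0 : 0 < r by case/andP: r01.
have := count_corners jJ rj Vr; set n := count _ _; set W := (size (L0 j) * size (L1 j))%N.
have W0 : (0 < W)%N.
  by rewrite /W muln_gt0; apply/andP; split; exact: size_numerators_gt0.
rewrite -(ler_nat R) natrM [leRHS]natrM -/K => nW.
have Wgt0 : 0 < W%:R :> R by rewrite ltr0n.
have rs : 1 <= C1 * 3 `^ s * r `^ s * W%:R.
  have step : 3 `^ (s * j.+1%:R) * r `^ s >= 1.
    rewrite (mulrC s) powRrM powR_mulrn//.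
    rewrite -powRM ?(ltW r0)//.
    have {1}<- : 1 `^ s = 1 :> R by rewrite powR1.
    apply: ge0_ler_powR; rewrite ?nnegrE ?(ltW s0) ?mulr_ge0 ?(ltW r0)//.
    by rewrite -ler_pdivrMl// mulr1 ltW.
  apply: le_trans step _; rewrite -[j.+1%:R]natr1 mulrDr mulr1 powRD ?pnatr_eq0 ?implybT//.
  have -> : C1 * 3 `^ s * r `^ s * W%:R = C1 * W%:R * 3 `^ s * r `^ s by ring.
  by rewrite ler_wpM2r ?powR_ge0// ler_wpM2r ?powR_ge0.
rewrite -(ler_pM2r Wgt0); apply: le_trans nW _.
have -> : K * C1 * 3 `^ s * r `^ s * (size (corners J))%:R * W%:R
   = K * (size (corners J))%:R * (C1 * 3 `^ s * r `^ s * W%:R) by ring.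
by rewrite ler_peMr// mulr_ge0// ltW.
Qed.

End cantor_dust.

(** * Runs of zeros *)

Section digits.
Local Open Scope nat_scope.
Variables (e : bool) (Q Z : nat -> nat).

(** The digits are 0 on each run of positions from [Q k] to [Z k], so that a
    number with these digits is within [3 ^ - Z k] of a fraction with denominator
    [3 ^ Q k]. The digit 1 just before the run, required when [e] holds, makes
    the numerator of this fraction prime to 3. *)
Definition digits (j : nat) : seq nat :=
  if `[< exists k, Q k <= j < Z k >] then [:: 0]
  else if e && `[< exists k, Q k = j.+1 >] then [:: 1] else [:: 0; 1; 2].

Lemma digits_lt3 j i : i \in digits j -> i < 3.
Proof.
rewrite /digits; case: ifP => _; last case: ifP => _; rewrite !inE.
- by move=> /eqP->.
- by move=> /eqP->.
- by move=> /or3P[] /eqP->.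
Qed.

Lemma digits_uniq j : uniq (digits j).
Proof. by rewrite /digits; case: ifP => // _; case: ifP. Qed.

Lemma digits_gt0 j : 0 < size (digits j).
Proof. by rewrite /digits; case: ifP => // _; case: ifP. Qed.

Lemma digits_run k j : Q k <= j < Z k -> digits j = [:: 0].
Proof. by move=> jk; rewrite /digits ifT//; apply/asboolP; exists k. Qed.

Hypothesis QZ : forall k, Q k <= Z k.
Hypothesis ZQ : forall k, Z k < Q k.+1.

Let Q_mono i k : i <= k -> Q i <= Q k.
Proof.
move=> /subnK <-; elim: (k - i) => // n ih; rewrite addSn.
exact: leq_trans ih (leq_trans (QZ _) (ltnW (ZQ _))).
Qed.

Let Z_mono i k : i <= k -> Z i <= Z k.
Proof.
move=> /subnK <-; elim: (k - i) => // n ih; rewrite addSn.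
exact: leq_trans ih (leq_trans (ltnW (ZQ _)) (QZ _)).
Qed.

Let not_run k j : Z k <= j < Q k.+1 -> ~ exists i, Q i <= j < Z i.
Proof.
move=> /andP[zj jq] [i /andP[qj jz]]; case: (leqP i k) => [/Z_mono|/Q_mono]; lia.
Qed.

Lemma digits_one k : e -> digits (Q k.+1).-1 = [:: 1].
Proof.
move=> eT; have := ZQ k => zq.
have nr : ~ exists i, Q i <= (Q k.+1).-1 < Z i by apply: (@not_run k); lia.
rewrite /digits ifF; last by apply/asboolP.
by rewrite eT ifT//; apply/asboolP; exists k.+1; lia.
Qed.

Lemma digits_free k j : Z k <= j < Q k.+1 - e -> size (digits j) = 3.
Proof.
move=> /andP[zj jq]; rewrite /digits ifF; last first.
  by apply/asboolP; apply: (@not_run k); lia.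
case: e jq => //= jq; rewrite ifF//; apply/asboolP => -[i iE].
by case: (leqP i k) => [/Q_mono|/Q_mono]; have := QZ k; lia.
Qed.

(** Only the free digits between the last two runs that start at [j] or earlier,
    and those after the second of these runs, are counted; the loss is small if
    each run starts much later than the end of the previous one. *)
Lemma size_numerators_digits k j : Q k.+1 <= j < Q k.+2 ->
  3 ^ (Q k.+1 - e - Z k + (j - Z k.+1)) <= size (numerators digits j).
Proof.
move=> /andP[qj jq]; have zq := ZQ k.
have first_run : 3 ^ (Q k.+1 - e - Z k) <= size (numerators digits (Q k.+1)).
  apply: (@leq_trans (size (numerators digits (Q k.+1 - e)))); last first.
    by apply: leq_size_numerators; [exact: digits_gt0|exact: leq_subr].
  rewrite (@size_numerators_free _ (Z k) (Q k.+1 - e)).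
  - by rewrite leq_pmulr// size_numerators_gt0//; exact: digits_gt0.
  - by case: e; lia.
  - by move=> i; exact: digits_free.
have [jz|zj] := leqP j (Z k.+1).
  have -> : j - Z k.+1 = 0 by lia.
  rewrite addn0; apply: leq_trans first_run _.
  by apply: leq_size_numerators => //; exact: digits_gt0.
rewrite (@size_numerators_free _ (Z k.+1) j) ?(ltnW zj)//.
  rewrite expnD mulnC leq_mul2l; apply/orP; right; apply: leq_trans first_run _.
  by apply: leq_size_numerators; [exact: digits_gt0|exact: QZ].
by move=> i /andP[zi ij]; apply: (@digits_free k.+1); case: e; lia.
Qed.

End digits.

Section growth.
Context {R : realType}.
Variables (Q M : nat -> nat).
Hypothesis QM : forall k, (Q k <= M k)%N.
Hypothesis MQ : forall k, (2 * M k < Q k.+1)%N.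

Lemma leq_run_start k : (k <= Q k)%N.
Proof.
elim: k => // k ih; apply: leq_ltn_trans ih _; have := QM k; have := MQ k; lia.
Qed.

Lemma between_consecutive (j : nat) : (Q 1 <= j)%N -> exists k, (Q k.+1 <= j < Q k.+2)%N.
Proof.
move=> q1; have QS k : (Q k < Q k.+1)%N by have := QM k; have := MQ k; lia.
have ex : exists n, (j < Q n)%N by exists j.+1; exact: leq_run_start.
case: (ex_minnP ex) => n jn nmin.
case: n jn nmin => [|[|n]] jn nmin.
- by have := QS 0%N; lia.
- by lia.
exists n; rewrite jn andbT leqNgt; apply/negP => /nmin; lia.
Qed.

(** The first coordinate has runs up to [M k] and the second one up to [2 * M k].
    For [j] between [Q k.+1] and [Q k.+2], the free digits before [Q k.+1] number
    about [2 * Q k.+1] in the two coordinates together, and those after the runs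
    at least [t0 * (j - M k.+1) + t1 * (j - 2 * M k.+1)]. Splitting [s] as
    [t0 + t1] replaces a discussion of the position of [j] by the linear
    hypothesis on [Q] and [M]. *)
Lemma digits_growth (s t0 t1 : R) : 0 <= t0 <= 1 -> 0 <= t1 <= 1 -> s = t0 + t1 ->
  (forall k, 3 * (M k)%:R + 1 + (t0 + 2 * t1) * (M k.+1)%:R <= 2 * (Q k.+1)%:R :> R) ->
  exists2 C1 : R, 0 < C1 & forall j, 3 `^ (s * j%:R) <=
    C1 * (size (numerators (digits false Q M) j) *
          size (numerators (digits true Q (fun k => 2 * M k)%N) j))%:R.
Proof.
move=> /andP[t00 t01] /andP[t10 t11] sE room.
have s0 : 0 <= s by rewrite sE addr_ge0.
have three1 : 1 <= 3 :> R by rewrite ler1n.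
exists (3 `^ (s * (Q 1)%:R)) => [|j]; first exact: powR_gt0.
set W := (_ * _)%N.
have W0 : 1 <= W%:R :> R.
  by rewrite ler1n muln_gt0 !size_numerators_gt0//; move=> *; exact: digits_gt0.
have [jQ|/between_consecutive[k kj]] := ltnP j (Q 1).
  apply: (@le_trans _ _ (3 `^ (s * (Q 1)%:R))); last by rewrite ler_peMr// powR_ge0.
  by rewrite ler_powR// ler_wpM2l// ler_nat ltnW.
have QZ k' : (Q k' <= 2 * M k')%N by have := QM k'; lia.
have MQ' k' : (M k' < Q k'.+1)%N by have := MQ k'; lia.
have h0 := size_numerators_digits false QM MQ' kj.
have h1 := size_numerators_digits true QZ MQ kj.
have := leq_mul h0 h1; rewrite -expnD -/W -(ler_nat R) => hW.
apply: (@le_trans _ _ W%:R); last first.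
  by rewrite ler_peMl// -[leLHS](@powRr0 R 3) ler_powR// mulr_ge0.
apply: le_trans hW; rewrite natrX -powR_mulrn// ler_powR//.
set n := (_ + _ + _)%N.
have nE : 2 * (Q k.+1)%:R - 3 * (M k)%:R - 1 + t0 * (j%:R - (M k.+1)%:R)
    + t1 * (j%:R - 2 * (M k.+1)%:R) <= n%:R :> R.
  have trunc1 : t0 * (j%:R - (M k.+1)%:R) <= (j - M k.+1)%N%:R :> R.
    have [jM|Mj] := leqP j (M k.+1).
      by apply: le_trans (ler0n _ _); rewrite mulr_ge0_le0// subr_le0 ler_nat.
    by rewrite natrB ?(ltnW Mj)// ler_piMl// subr_ge0 ler_nat ltnW.
  have trunc2 : t1 * (j%:R - 2 * (M k.+1)%:R) <= (j - 2 * M k.+1)%N%:R :> R.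
    rewrite -natrM; have [jM|Mj] := leqP j (2 * M k.+1)%N.
      by apply: le_trans (ler0n _ _); rewrite mulr_ge0_le0// subr_le0 ler_nat.
    by rewrite natrB ?(ltnW Mj)// ler_piMl// subr_ge0 ler_nat ltnW.
  have e0 : (Q k.+1)%:R - (M k)%:R <= (Q k.+1 - false - M k)%N%:R :> R.
    by rewrite subn0 natrB// ltnW.
  have e1 : (Q k.+1)%:R - 1 - 2 * (M k)%:R <= (Q k.+1 - true - 2 * M k)%N%:R :> R.
    have -> : (Q k.+1 - true - 2 * M k = Q k.+1 - (1 + 2 * M k))%N by rewrite subnDA.
    by rewrite natrB ?natrD ?natrM; [lra|exact: MQ].
  by rewrite /n !natrD; lra.
apply: le_trans nE; have := room k; rewrite sE; lra.
Qed.

End growth.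

(** * Discrepancy on the Cantor sets *)

Section stage_discrepancy.
Context {R : realType} {d : nat}.
Variables (c : 'I_d.+2 -> nat) (J0 : nat) (Q M : nat -> nat).
Hypothesis QM : forall k, (Q k <= M k)%N.
Hypothesis MQ : forall k, (2 * M k < Q k.+1)%N.
Local Notation dig0 := (digits false Q M).
Local Notation dig1 := (digits true Q (fun k => 2 * M k)%N).
Local Notation stage := (@cantor_stage R d c J0 dig0 dig1).

Let pow3_gt0 n : 0 < 3 ^+ n :> R. Proof. exact: exprn_gt0. Qed.
Let pow3_neq0 n : 3 ^+ n != 0 :> R. Proof. by rewrite gt_eqF. Qed.

Lemma run_approx (dig : nat -> seq nat) (q z m a : nat) (x : R) : (q <= z)%N ->
  (forall j, (q <= j < z)%N -> dig j = [:: 0%N]) -> m \in numerators dig z ->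
  (a%:R + m%:R / 3 ^+ z) / 3 ^+ J0 <= x <=
    (a%:R + m%:R / 3 ^+ z) / 3 ^+ J0 + 1 / 3 ^+ z / 3 ^+ J0 ->
  exists2 m', m' \in numerators dig q &
    (a * 3 ^ q + m')%:R / 3 ^+ (q + J0) <= x <=
    (a * 3 ^ q + m')%:R / 3 ^+ (q + J0) + (3 ^+ z)^-1.
Proof.
move=> qz run mz xm.
have [m' m'q mE] := numerators_zero_run qz run mz.
exists m' => //; move: xm; rewrite mE natrM.
have -> : (a%:R + (3 ^ (z - q))%N%:R * m'%:R / 3 ^+ z) / 3 ^+ J0
    = (a * 3 ^ q + m')%:R / 3 ^+ (q + J0) :> R.
  rewrite -{2}(subnK qz) natrD !natrM !natrX !exprD; field.
  by rewrite !pow3_neq0.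
move=> /andP[-> /le_trans]/=; apply; rewrite lerD2l mul1r.
by rewrite ler_piMr ?invr_ge0 ?exprn_ge0// invf_le1// exprn_ege1// ler1n.
Qed.

Lemma stage_approx x k : (\bigcap_J stage J) x -> exists b a : nat,
  [/\ (3 %| a.+2)%N,
      b%:R / 3 ^+ (Q k.+1 + J0) <= x 0 ord0 <=
        b%:R / 3 ^+ (Q k.+1 + J0) + (3 ^+ M k.+1)^-1,
      a%:R / 3 ^+ (Q k.+1 + J0) <= x 0 (lift ord0 ord0) <=
        a%:R / 3 ^+ (Q k.+1 + J0) + (3 ^+ M k.+1)^-1 ^+ 2 &
      forall i : 'I_d, x 0 (lift ord0 (lift ord0 i))
        = (c (lift ord0 (lift ord0 i)))%:R / 3 ^+ J0].
Proof.
move=> xstage.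
have [m0 [m1 [m0L m1L x0]]] := xstage (M k.+1) I.
have [n0 [n1 [n0L n1L x1]]] := xstage (2 * M k.+1)%N I.
have QZ k' : (Q k' <= 2 * M k')%N by have := QM k'; lia.
have xb := x0 ord0; rewrite !mxE /edge/= in xb.
have [b' _ b'E] := run_approx (QM k.+1) (@digits_run false Q M k.+1) m0L xb.
have xa := x1 (lift ord0 ord0); rewrite !mxE /edge/= in xa.
have [a' a'L a'E] := run_approx (QZ k.+1)
  (@digits_run true Q (fun k => 2 * M k)%N k.+1) n1L xa.
exists (c ord0 * 3 ^ Q k.+1 + b')%N, (c (lift ord0 ord0) * 3 ^ Q k.+1 + a')%N.
split=> //.
- have Qpos : (0 < Q k.+1)%N by apply: leq_ltn_trans (MQ k).
  move: a'L; rewrite -{1}(prednK Qpos) => /numeratorsS_P[m' [e [_ + ->]]].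
  rewrite (@digits_one true _ (fun k => 2 * M k)%N)// inE => /eqP->.
  rewrite -{1}(prednK Qpos) expnS.
  have -> : (c (lift ord0 ord0) * (3 * 3 ^ (Q k.+1).-1) + (3 * m' + 1)).+2
    = (3 * (c (lift ord0 ord0) * 3 ^ (Q k.+1).-1 + m' + 1))%N by ring.
  exact: dvdn_mulr.
- have -> : (3 ^+ M k.+1)^-1 ^+ 2 = (3 ^+ (2 * M k.+1))^-1 :> R.
    by rewrite exprVn -exprM mulnC.
  exact: a'E.
move=> i; have := x0 (lift ord0 (lift ord0 i)); rewrite !mxE /edge/= !mul0r !addr0.
by move=> /le_anti.
Qed.

Lemma expnD_multiple (w v p e : nat) : exists k, ((w + p * v) ^ e = w ^ e + p * k)%N.
Proof.
elim: e => [|e [k ih]]; first by exists 0%N; rewrite muln0.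
exists (w * k + v * (w ^ e + p * k))%N; rewrite !expnS ih; ring.
Qed.

(** With [p = 3 ^ P] the common denominator [3 ^ (Q k.+1 + J0)] is [p ^ 2], and the
    errors of the two rational approximations are at most [1 / N] and
    [1 / N ^ 2] for [N = 3 ^ M k.+1]. The remaining coordinates have denominator
    [3 ^ J0], a divisor of [p], so that modulo 1 their terms have period [p]. *)
Lemma stage_discrepancy x k P : (\bigcap_J stage J) x ->
  (Q k.+1 + J0 = 2 * P)%N -> (J0 <= P)%N -> (2 * P <= M k.+1)%N ->
  exists2 n, (n <= 3 ^ M k.+1)%N &
    3 ^+ (M k.+1 - P) <= 16 * pi * (1 + 4 * pi) * discrepancy (weyl_seq x) n.
Proof.
move=> xstage QP J0P PM.
have [b [a [a3 xb xa xc]]] := stage_approx k xstage.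
have PM' : (P <= M k.+1)%N by lia.
pose p := (3 ^ P)%N; pose V := (3 ^ (M k.+1 - P))%N.
have pVE : (p * V = 3 ^ M k.+1)%N by rewrite -expnD subnKC.
pose h (n : nat) : R := \sum_(i < d) x 0 (lift ord0 (lift ord0 i)) * n%:R ^+ i.+3.
pose y (n : nat) : R := \sum_(i < d.+2) x 0 i * n%:R ^+ i.+1.
have p2 : (p%:R : R) ^+ 2 = 3 ^+ (Q k.+1 + J0).
  by rewrite /p natrX -exprM mulnC QP.
have pV1 : (p * V)%:R^-1 = (3 ^+ M k.+1)^-1 :> R by rewrite pVE natrX.
rewrite -pVE -natrX.
apply: (@quadratic_discrepancy R p V a b h y
  (x 0 ord0 - b%:R / p%:R ^+ 2) (x 0 (lift ord0 ord0) - a%:R / p%:R ^+ 2));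
  rewrite ?pV1 ?p2.
- by rewrite expn_gt0.
- by rewrite expn_gt0.
- by rewrite dvdn_exp2l//; lia.
- have P0 : (0 < P)%N by have := MQ k; lia.
  rewrite coprime_pexpl// prime_coprime// Euclid_dvdM//=; apply/negP => a3'.
  by have := dvdn_sub a3 a3'; rewrite -[a.+2]addn2 addKn.
- move=> w v.
  pose q (i : 'I_d) := (((w + p * v) ^ i.+3 - w ^ i.+3) %/ 3 ^ J0)%N.
  have qE (i : 'I_d) : ((w + p * v) ^ i.+3 = w ^ i.+3 + 3 ^ J0 * q i)%N.
    rewrite /q; have [n ->] := expnD_multiple w v p i.+3.
    rewrite addKn /p -(subnKC J0P) expnD -!mulnA mulKn// expn_gt0//.
  exists (\sum_(i < d) c (lift ord0 (lift ord0 i)) * q i)%N.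
  rewrite /h natr_sum -big_split/=; apply: eq_bigr => i _.
  rewrite xc -!natrX qE natrD !natrM !natrX; field.
  exact: pow3_neq0.
- by rewrite subr_ge0 lerBlDl.
- by rewrite subr_ge0 lerBlDl.
move=> n; rewrite /y big_ord_recl big_ord_recl /= /h expr1.
by rewrite addrA addrAC /bump/=; field; exact: pow3_neq0.
Qed.

End stage_discrepancy.

(** * Choice of the parameters *)

(** The exponent of the denominator is even because the Gauss sums need a square
    denominator. *)
Lemma triadic_subcube (R : realType) (d : nat) (Q : set 'rV[R]_d) :
  is_cube d Q -> Q `<=` torus R d ->
  exists (h : nat) (c : 'I_d -> nat), forall x : 'rV[R]_d,
    (forall i, (c i)%:R / 3 ^+ (2 * h) <= x 0 i <= (c i).+1%:R / 3 ^+ (2 * h)) -> Q x.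
Proof.
move=> [z [l [bl [br [l0 ->]]]]] Qtorus.
pose mid : 'rV[R]_d := \row_i (z 0 i + l / 2).
have mid0 i : 0 <= mid 0 i.
  have : torus R d mid.
    apply: Qtorus => j; rewrite mxE in_itv/=.
    by case: (bl j); case: (br j) => /=; apply/andP; split; lra.
  by move=> /(_ i)/andP[].
pose h := (Num.truncn (2 / l)).+1; pose b : R := 3 ^+ (2 * h).
have b0 : 0 < b by exact: exprn_gt0.
have bl1 : 2 / l < b.
  apply: lt_trans (truncnS_gt _) _; rewrite /b exprM -!natrX ltr_nat.
  exact: ltn_expl.
exists h, (fun i => Num.truncn (b * mid 0 i)) => x xc i; rewrite -/b in xc *.
have := truncn_itv (mulr_ge0 (ltW b0) (mid0 i)).
have := xc i; set m := Num.truncn _; rewrite -natr1 !(mulrC _ b^-1).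
rewrite ler_pdivrMl// ler_pdivlMl// => /andP[xl xr] /andP[ml mr].
have mE : mid 0 i = z 0 i + l / 2 by rewrite mxE.
have bl2 : 2 < b * l by rewrite -ltr_pdivrMr.
have ox : z 0 i < x 0 i by rewrite -(ltr_pM2l b0); rewrite mE in ml mr *; lra.
have xo : x 0 i < z 0 i + l by rewrite -(ltr_pM2l b0); rewrite mE in ml mr *; lra.
by rewrite in_itv/=; case: (bl i); case: (br i) => /=; rewrite ?(ltW ox) ?(ltW xo) ?ox ?xo.
Qed.

Lemma infinite_set_unbounded (A : set nat) :
  (forall n, exists2 m, (n <= m)%N & A m) -> infinite_set A.
Proof.
move=> unb /finite_fsetP[X AX].
have [m nm Am] := unb (\max_(k <- finmap.enum_fset X) k).+1.
have mX : m \in finmap.enum_fset X by rewrite AX in Am.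
have := @leq_bigmax_seq _ (finmap.enum_fset X) (fun=> true) (fun k => k) m mX isT.
by rewrite leqNgt nm.
Qed.

(** Geometric sequences [Q k] of large ratio, and [M k] the integral part of
    [tau * Q k]: the runs before stage [k] then take up a small proportion of the
    first [Q k] digits. The condition on [(1 - alpha) * tau] is what makes
    [N / sqrt q] exceed [N ^ alpha] for [q = 3 ^ (2 * P)] and [N = 3 ^ M], while
    the one on [u * tau] keeps the dimension up. *)
Lemma stage_lengths (R : realType) (alpha tau u C : R) (h : nat) :
  0 < alpha < 1 -> 1 < tau -> 2^-1 < (1 - alpha) * tau -> 0 <= u -> u * tau < 2 ->
  exists Q M P : nat -> nat,
  [/\ forall k, (Q k <= M k)%N, forall k, (2 * M k < Q k.+1)%N,
      forall k, 3 * (M k)%:R + 1 + u * (M k.+1)%:R <= 2 * (Q k.+1)%:R :> R &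
      forall k, [/\ (Q k.+1 + 2 * h = 2 * P k)%N, (2 * h <= P k)%N,
        (2 * P k <= M k.+1)%N &
        C * (3 ^+ M k.+1) `^ alpha <= 3 ^+ (M k.+1 - P k)]].
Proof.
move=> /andP[alpha0 alpha1] tau1 atau u0 utau.
(* The ratio [a] is chosen for the conditions between consecutive stages, and
   the first term [n0] for those within a stage, where constants are lost; [g]
   is such that [C <= 3 ^ g]. *)
pose a := (Num.truncn (2 * tau + (3 * tau + 1) / (2 - u * tau))).+1.
pose g := (Num.truncn C).+1.
pose kap := (1 - alpha) * tau - 2^-1.
have kap0 : 0 < kap by rewrite subr_gt0.
pose n0 := (Num.truncn ((2 * h%:R + 1) / (tau - 1) + (2 * h%:R + g%:R + 1) / kap + h%:R)).+1.
have tau10 : 0 < tau - 1 by rewrite subr_gt0.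
have utau0 : 0 < 2 - u * tau by rewrite subr_gt0.
have part1 : 0 <= (2 * h%:R + 1) / (tau - 1)
  by rewrite divr_ge0 ?(ltW tau10)// addr_ge0// mulr_ge0.
have part2 : 0 <= (2 * h%:R + g%:R + 1) / kap
  by rewrite divr_ge0 ?(ltW kap0)// !addr_ge0// mulr_ge0.
have h0 : 0 <= h%:R :> R by [].
have part3 : 0 <= (3 * tau + 1) / (2 - u * tau) by rewrite divr_ge0 ?(ltW utau0)//; lra.
have n0gt := truncnS_gt ((2 * h%:R + 1) / (tau - 1) + (2 * h%:R + g%:R + 1) / kap + h%:R).
rewrite -/n0 in n0gt.
have agt := truncnS_gt (2 * tau + (3 * tau + 1) / (2 - u * tau)).
rewrite -/a in agt.
have n01 : 2 * h%:R + 1 <= (tau - 1) * n0%:R.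
  by rewrite [leRHS]mulrC -ler_pdivrMr//; lra.
have n02 : 2 * h%:R + g%:R + 1 <= kap * n0%:R.
  by rewrite [leRHS]mulrC -ler_pdivrMr//; lra.
have a1 : 2 * tau < a%:R by lra.
have a2 : 3 * tau + 1 <= (2 - u * tau) * a%:R.
  by rewrite [leRHS]mulrC -ler_pdivrMr//; lra.
pose Q k := (2 * n0 * a ^ k)%N.
pose M k := Num.truncn (tau * (Q k)%:R).
pose P k := (n0 * a ^ k.+1 + h)%N.
have QS k : (Q k.+1)%:R = a%:R * (Q k)%:R :> R.
  by rewrite /Q expnS -natrM; congr _%:R; ring.
have Qn0 k : 2 * n0%:R <= (Q k)%:R :> R.
  by rewrite -natrM ler_nat leq_pmulr// expn_gt0.
have n0ge1 : 1 <= n0%:R :> R by rewrite ler1n.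
have tauQ k : 0 <= tau * (Q k)%:R by rewrite mulr_ge0//; lra.
have Mle k : (M k)%:R <= tau * (Q k)%:R by rewrite truncn_le.
have Mgt k : tau * (Q k)%:R < (M k)%:R + 1 by rewrite natr1 truncnS_gt.
have big k (e : R) : 0 <= e -> e * n0%:R <= e * (Q k)%:R.
  by move=> e0; apply: ler_wpM2l => //; have := Qn0 k; lra.
have QhM k : (Q k + 2 * h <= M k)%N.
  rewrite -ltnS -(ltr_nat R) -natr1 natrD natrM.
  by have := big k _ (ltW tau10); have := Mgt k; lra.
have PE k : (Q k.+1 + 2 * h = 2 * P k)%N by rewrite /Q /P; ring.
exists Q, M, P; split=> k.
- by apply: leq_trans (QhM k); exact: leq_addr.
- rewrite -(ltr_nat R) natrM QS; have := Mle k.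
  have : 2 * tau * (Q k)%:R < a%:R * (Q k)%:R by rewrite ltr_pM2r//; have := Qn0 k; lra.
  by lra.
- have uM : u * (M k.+1)%:R <= u * tau * (a%:R * (Q k)%:R).
    by rewrite -QS -mulrA ler_wpM2l.
  have : (3 * tau + 1) * (Q k)%:R <= (2 - u * tau) * a%:R * (Q k)%:R by rewrite ler_wpM2r.
  by rewrite QS; have := Mle k; have := Qn0 k; lra.
have PM : (2 * P k <= M k.+1)%N by rewrite -PE.
split=> //.
  have hn0 : (h <= n0)%N.
    by rewrite -(ler_nat R); lra.
  rewrite /P mul2n -addnn leq_add2r; apply: leq_trans hn0 _.
  by rewrite leq_pmulr// expn_gt0.
have Cg : C <= 3 `^ g%:R.
  rewrite powR_mulrn//; apply: ltW; apply: lt_le_trans (truncnS_gt _) _.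
  by rewrite -natrX ler_nat ltnW// ltn_expl.
apply: (@le_trans _ _ (3 `^ g%:R * 3 `^ (alpha * (M k.+1)%:R))).
  by rewrite -[3 ^+ M k.+1]powR_mulrn// -powRrM (mulrC alpha) ler_wpM2r// powR_ge0.
rewrite -powRD ?pnatr_eq0 ?implybT// -powR_mulrn// ler_powR ?ler1n//.
have PM' : (P k <= M k.+1)%N by apply: leq_trans PM; rewrite leq_pmull.
rewrite natrB//.
have PR : 2 * (P k)%:R = (Q k.+1)%:R + 2 * h%:R :> R by rewrite -!natrM -natrD PE.
have : (1 - alpha) * (tau * (Q k.+1)%:R) <= (1 - alpha) * ((M k.+1)%:R + 1).
  by apply: ler_wpM2l; [lra|exact: ltW (Mgt _)].
have := big k.+1 _ (ltW kap0); rewrite /kap in n02 *.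
lra.
Qed.

Section dimension.
Context {R : realType} {d : nat}.

(** The exponent [tau] of the Cantor set has to satisfy [1 < tau] and
    [1 / (2 * (1 - alpha)) < tau] for the discrepancy, and [s * tau < 3 / 2] for
    the dimension; the two bounds on [s] leave room for it. The exponent [s] is
    then taken from the first coordinate as far as possible, since that one has
    the shorter runs. *)
Lemma large_discrepancy_measure (alpha s : R) (Q : set 'rV[R]_d.+2) :
  0 < alpha < 1 -> 0 < s -> s < 3 / 2 -> s < 3 * (1 - alpha) ->
  is_cube d.+2 Q -> Q `<=` torus R d.+2 ->
  hausdorff_measure s (large_discrepancy alpha d.+2 `&` Q) <> 0%E.
Proof.
move=> alpha01 s0 s32 salpha Qcube Qtorus; have /andP[alpha0 alpha1] := alpha01.
have [h [c cQ]] := triadic_subcube Qcube Qtorus.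
have [tau [tau1 atau stau]] : exists tau,
    [/\ 1 < tau, 2^-1 < (1 - alpha) * tau & s * tau < 3 / 2].
  have a1 : 0 < 1 - alpha by rewrite subr_gt0.
  pose lo := Num.max 1 (2^-1 / (1 - alpha)).
  have lohi : lo < 3 / 2 / s.
    rewrite gt_max ltr_pdivlMr// mul1r s32/= ltr_pdivlMr// mulrAC ltr_pdivrMr//; lra.
  have := midf_lt lohi => -[lom mhi]; exists ((lo + 3 / 2 / s) / 2).
  have : 1 <= lo by rewrite le_max lexx.
  have : 2^-1 / (1 - alpha) <= lo by rewrite le_max lexx orbT.
  rewrite ler_pdivrMr// => lo1 lo2; split; first exact: le_lt_trans lom.
  - by rewrite mulrC; apply: (le_lt_trans lo1); rewrite ltr_pM2r.
  - by rewrite mulrC -ltr_pdivlMr.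
have [t0 [t1 [t001 t101 sE utau]]] : exists t0 t1 : R,
    [/\ 0 <= t0 <= 1, 0 <= t1 <= 1, s = t0 + t1 & (t0 + 2 * t1) * tau < 2].
  have [s1|s1] := leP s 1; [exists s, 0|exists 1, (s - 1)].
    by split; rewrite ?lexx ?ler01 ?(ltW s0)//; lra.
  by split; [rewrite ler01 lexx|apply/andP; split; lra|ring|lra].
have u0 : 0 <= t0 + 2 * t1 by move: t001 t101 => /andP[? _] /andP[? _]; lra.
have [q [M [P [QM MQ room PP]]]] :=
  stage_lengths (16 * pi * (1 + 4 * pi)) h alpha01 tau1 atau u0 utau.
have [C1 C10 growth] := digits_growth QM MQ t001 t101 sE room.
pose stage := @cantor_stage R d c (2 * h) (digits false q M)
  (digits true q (fun k => 2 * M k)%N).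
apply: (@cantor_dust_measure R d c (2 * h) (digits false q M)
  (digits true q (fun k => 2 * M k)%N) _ _ _ _ _ _ s C1) => //.
1,2: by move=> j e; exact: digits_lt3.
1,2: by move=> j; exact: digits_uniq.
1,2: by move=> j; exact: digits_gt0.
move=> x xstage.
have Qx : Q x.
  apply: cQ => i; have [m0 [m1 [m0L m1L /(_ i)]]] := xstage 0%N I.
  move: m0L m1L; rewrite !inE => /eqP-> /eqP->.
  rewrite !mxE /edge !expr0 !divr1.
  have -> : free_coord 0 0 i = 0%N by rewrite /free_coord; case: ifP => // _; case: ifP.
  rewrite addr0 -mulrDl => /andP[-> /le_trans]; apply.
  by rewrite ler_pM2r ?invr_gt0 ?exprn_gt0// -natrD ler_nat -[(c i).+1]addn1 leq_add2l; case: (i < 2)%N.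
split=> //; split; first exact: Qtorus.
apply: infinite_set_unbounded => n.
pose k := Num.truncn (n%:R `^ alpha^-1 : R).
have [QP hP PM CP] := PP k.
have [N NM DN] := stage_discrepancy QM MQ xstage QP hP PM.
set D := discrepancy _ _ in DN.
have pi0 := @pi_gt0 R.
have DN' : (3 ^+ M k.+1) `^ alpha <= D.
  have C0 : 0 < 16 * pi * (1 + 4 * pi) :> R by rewrite !mulr_gt0// addr_gt0// mulr_gt0.
  by rewrite -(ler_pM2l C0); exact: le_trans CP DN.
exists N.
  have kM : (k < M k.+1)%N := leq_trans (leq_run_start QM MQ k.+1) (QM k.+1).
  rewrite -(ler_nat R); apply: le_trans (discrepancy_le (weyl_seq x) N).
  apply: le_trans DN'.
  have -> : (n%:R : R) = (n%:R `^ alpha^-1) `^ alpha.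
    by rewrite -powRrM mulVf ?gt_eqF// powRr1.
  apply: ge0_ler_powR; rewrite ?nnegrE ?powR_ge0 ?exprn_ge0 ?(ltW alpha0)//.
  apply: ltW; apply: lt_trans (truncnS_gt _) _; rewrite -/k -natrX ltr_nat.
  by apply: leq_ltn_trans kM _; exact: ltn_expl.
rewrite /=; apply: le_trans DN'.
apply: ge0_ler_powR; rewrite ?nnegrE ?exprn_ge0 ?(ltW alpha0)//.
by rewrite -natrX ler_nat.
Qed.

(** The bound found for two coordinates holds in every dimension [d >= 2]; as
    [kappa] is at most [1 / 2], it implies the one asked for [d >= 3]. *)
Lemma large_discrepancy_dim (alpha : R) (Q : set 'rV[R]_d.+2) : 0 < alpha < 1 ->
  is_cube d.+2 Q -> Q `<=` torus R d.+2 ->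
  ((Num.min (3 / 2) (3 * (1 - alpha)))%:E <=
    hausdorff_dim (large_discrepancy alpha d.+2 `&` Q))%E.
Proof.
move=> alpha01 Qcube Qtorus; apply: le_ereal_inf_tmp => _ [s [s0 Hs] <-].
rewrite lee_fin leNgt; apply/negP; rewrite lt_min => /andP[s32 salpha].
exact: (large_discrepancy_measure alpha01 s0 s32 salpha Qcube Qtorus Hs).
Qed.

End dimension.

Lemma kappa_le (R : realType) (d : nat) : kappa R d <= 2^-1.
Proof.
rewrite /kappa big_seq; elim/big_ind: _ => [|x y|nu].
- by rewrite invr_ge0.
- by rewrite ge_max => -> ->.
rewrite mem_index_iota => /andP[nu1 _]; rewrite ge_min; apply/orP; left.
by rewrite mul1r lef_pV2 ?posrE ?mulr_gt0 ?ltr0n// ler_peMr// ler1n.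
Qed.

Theorem theorem1p10 (R : realType) (alpha : R) (alpha01 : 0 < alpha < 1) :
  (forall Q : set 'rV[R]_2, is_cube 2 Q -> Q `<=` torus R 2 ->
    ((Num.min (3 / 2) (3 * (1 - alpha)))%R%:E
       <= hausdorff_dim (large_discrepancy alpha 2%N `&` Q))%E) /\
  (forall d : nat, (3 <= d)%N ->
    forall Q : set 'rV[R]_d, is_cube d Q -> Q `<=` torus R d ->
    ((Num.min (kappa R d) (2 * kappa R d * (1 - alpha)))%R%:E
       <= hausdorff_dim (large_discrepancy alpha d `&` Q))%E).
Proof.
split=> [Q Qcube Qtorus|[|[|d]]// _ Q Qcube Qtorus].
  exact: large_discrepancy_dim.
apply: le_trans (large_discrepancy_dim alpha01 Qcube Qtorus).
have k2 := kappa_le R d.+2; have /andP[a0 a1] := alpha01.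
rewrite lee_fin le_min !ge_min; apply/andP; split; apply/orP; [left; lra|right].
by rewrite ler_wpM2r//; lra.
Qed.
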